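(* Let $h=\prod_{i=1}^{t}p_i^{s_i}$, where $p_1,\dots,p_t$ are pairwise distinct primes ($t\ge 1$) and $s_1,\dots,s_t$ are positive integers. Let $n,m,r$ be integers with $2\le r\le m+1\le n$ and $n\geq 2m$. Suppose that $\mathcal{F}$ is a maximum clique of $G_r(m,n,\mathbb{Z}_{h})$. Then: (i) the clique number of $G_r(m,n,\mathbb{Z}_{h})$ is $\prod_{i=1}^tp_i^{(s_i-1)(n-m)(r-1)}{n-m+r-1\brack r-1}_{p_i}$; (ii) $\pi_i(\mathcal{F})=\{\pi_i(F):F\in\mathcal{F}\}$ is a maximum clique of $G_r(m,n,\mathbb{Z}_{p_i^{s_i}})$ for all $i\in\{1,\dots,t\}$.
   Context: For an integer $k\geq 2$ let $\mathbb{Z}_k=\mathbb{Z}/k\mathbb{Z}$ and $\mathbb{Z}_k^n$ the module of row vectors of length $n$. The following definitions apply for $k=h$ and $k=p_i^{s_i}$. Vectors $\alpha_1,\dots,\alpha_l\in\mathbb{Z}_k^n$ form a unimodular vector subset if the $l\times n$ matrix with rows $\alpha_1,\dots,\alpha_l$ has a right inverse over $\mathbb{Z}_k$. For a linear subset (submodule) $V\subseteq\mathbb{Z}_k^n$, $\dim(V)$ is the maximum number of vectors in a unimodular vector subset of $V$ ($0$ if $V$ contains no unimodular vector). An $m$-subspace of $\mathbb{Z}_k^n$ is a linear subset having a basis of $m$ vectors which is unimodular; the $0$-subspace is $\{0\}$. ${\mathbb{Z}_k^n\brack m}$ is the set of all $m$-subspaces of $\mathbb{Z}_k^n$. For $2\le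 r\le m+1\le n$, the generalized Grassmann graph $G_r(m,n,\mathbb{Z}_k)$ has vertex set ${\mathbb{Z}_k^n\brack m}$, and two distinct vertices $A,B$ are adjacent if $\dim(A\cap B)>m-r$. A clique is a set of pairwise adjacent vertices; a maximum clique is a clique of maximum cardinality; the clique number is the cardinality of a maximum clique. $\pi_i$ denotes the map ${\mathbb{Z}_h^n\brack m}\to{\mathbb{Z}_{p_i^{s_i}}^n\brack m}$ induced by entrywise reduction modulo $p_i^{s_i}$ (applied to a matrix whose rows form a unimodular basis of the subspace; equivalently, the image of the subspace under coordinatewise reduction). Gaussian binomial: ${a\brack b}_{p}=\prod_{j=0}^{b-1}\frac{p^{a-j}-1}{p^{b-j}-1}$ (equal to $1$ if $b=0$). *)

(* Defs.v *)
From HB Require Import structures.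
From mathcomp Require Import all_boot all_order all_fingroup all_algebra.

Set Implicit Arguments.
Unset Strict Implicit.
Unset Printing Implicit Defensive.

Import GRing.Theory.
Local Open Scope ring_scope.

(* Throughout, 'Z_k is Z/kZ only for k >= 2 (it is Z/2Z for k = 0, 1). *)

Section Subspaces.
Variables k n : nat.

Definition unimodular l (M : 'M['Z_k]_(l, n)) : bool :=
  [exists N : 'M['Z_k]_(n, l), M *m N == 1%:M].

Lemma unimodular_leq l (M : 'M['Z_k]_(l, n)) : unimodular M -> (l <= n)%N.
Proof.
case/existsP=> N /eqP MN1.
have injM : injective (fun u : 'rV['Z_k]_l => u *m M).
  by move=> u v /(congr1 (mulmx^~ N)); rewrite -!mulmxA MN1 !mulmx1.
have := leq_card _ injM; rewrite !card_mx !mul1n leq_exp2l //.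
by rewrite card_ord.
Qed.

(* The bound l <= n loses nothing, by unimodular_leq; l = 0 always qualifies. *)
Definition zdim (V : {set 'rV['Z_k]_n}) : nat :=
  \max_(l < n.+1 | [exists M : 'M['Z_k]_(l, n),
                      unimodular M && [forall i, row i M \in V]]) l.

Lemma zdim_max (V : {set 'rV['Z_k]_n}) l (M : 'M['Z_k]_(l, n)) :
  unimodular M -> (forall i, row i M \in V) -> (l <= zdim V)%N.
Proof.
move=> uM MV; have ln : (l < n.+1)%N by rewrite ltnS (unimodular_leq uM).
apply: (@leq_bigmax_cond _ _ (fun l : 'I_n.+1 => l : nat) (Ordinal ln)).
by apply/existsP; exists M; rewrite uM; apply/forallP.
Qed.

Definition is_basis m (M : 'M['Z_k]_(m, n)) (V : {set 'rV['Z_k]_n}) : bool :=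
  injectiveb (fun u : 'rV['Z_k]_m => u *m M)
  && (V == [set u *m M | u : 'rV['Z_k]_m]).

Definition msubspaces (m : nat) : {set {set 'rV['Z_k]_n}} :=
  [set V | [exists M : 'M['Z_k]_(m, n), unimodular M && is_basis M V]].

(* The condition is dim (A :&: B) > m - r, where m - r may equal -1. *)
Definition grassmann_adj (r m : nat) : rel {set 'rV['Z_k]_n} :=
  fun A B => (A != B) && (m < zdim (A :&: B) + r)%N.

End Subspaces.

Arguments msubspaces : clear implicits.
Arguments grassmann_adj : clear implicits.

Section Cliques.
Variables (T : finType) (V : {set T}) (e : rel T).

Definition is_clique (C : {set T}) : bool :=
  (C \subset V) && [forall x in C, forall y in C, (x != y) ==> e x y].

Definition clique_number : nat := \max_(C : {set T} | is_clique C) #|C|.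

Definition is_maximum_clique (C : {set T}) : Prop :=
  is_clique C /\ forall C' : {set T}, is_clique C' -> (#|C'| <= #|C|)%N.

End Cliques.

Definition grassmann_clique_number (r m n k : nat) : nat :=
  clique_number (msubspaces k n m) (grassmann_adj k n r m).

Definition grassmann_maximum_clique (r m n k : nat)
    (C : {set {set 'rV['Z_k]_n}}) : Prop :=
  is_maximum_clique (msubspaces k n m) (grassmann_adj k n r m) C.

Arguments grassmann_maximum_clique : clear implicits.

(* A ring morphism Z/hZ -> Z/kZ when k divides h. *)
Definition Zred (h k : nat) (x : 'Z_h) : 'Z_k := (nat_of_ord x)%:R.

Definition Vred (h k n : nat) (V : {set 'rV['Z_h]_n}) : {set 'rV['Z_k]_n} :=
  [set map_mx (@Zred h k) v | v in V].

Definition gauss_binom (p a b : nat) : rat :=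
  \prod_(j < b) ((p%:R ^+ (a - j) - 1) / (p%:R ^+ (b - j) - 1)).

(* Main.v *)
From HB Require Import structures.
Require Import Defs.
From mathcomp Require Import all_boot all_order all_fingroup all_algebra.
From mathcomp Require Import all_field mxabelem.
From mathcomp Require Import ring zify.

Set Implicit Arguments.
Unset Strict Implicit.
Unset Printing Implicit Defensive.

Import Order.TTheory GRing.Theory Num.Theory.
Local Open Scope ring_scope.

(** Write [u = r - 1], [d = m - u] and [N = n - m]. A set of [m]-subspaces is a
    clique exactly when any two of its members share a free summand of rank [d],
    so that the clique number measures the largest [d]-intersecting families.

    Chinese remainder. An [m]-subspace of (Z/h)^n is the same thing as a family
    of [m]-subspaces of the (Z/p_i^s_i)^n, and two of them share a free summand
    of rank [d] if and only if all their reductions do. Hence a clique embeds in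
    the product of its reductions, which are cliques, and a product of cliques
    is a clique. So the clique number is multiplicative, and for a maximum
    clique both inequalities are equalities, which makes every reduction
    maximum.

    Prime powers. All subspaces that contain a fixed free summand of rank [d]
    form a clique; counting unimodular matrices gives its cardinality
    [p ^ ((s - 1) * (u * N)) * [N + u choose u]_p] (star_clique_ge). Conversely
    (card_clique_le), reduction modulo [p] maps a clique to a [d]-intersecting
    family over F_p. Subspaces with the same reduction are, in suitable
    coordinates, graphs of matrices that vanish modulo [p]; comparing their
    base-[p] digits one at a time, each digit runs over a set of matrices over
    F_p with pairwise differences of rank at most [u], so a fibre has at most
    [p ^ (u * N * (s - 1))] elements.

    Prime fields. Both remaining bounds, [q ^ (u * N)] for sets of [m * N]
    matrices whose differences have rank at most [u] (the Singleton bound for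
    the rank metric in its anticode form) and [[N + u choose u]_q] for
    [d]-intersecting families (the theorem of Frankl and Wilson, for
    [2 * m <= n]), come from one linear programming argument. For any weight
    [w >= 0] on ranks, exists_posdef_kernel produces a positive definite
    function [g] on [m * N] matrices with [g X = al * [X = 0] - w (rank X)] when
    [rank X <= u], where [al] is the sum of [w] over all [u * N] matrices.
    Summing [g] over the differences of a set yields a bound by [al] when
    [w = 1]. For subspaces, fix a frame [C] of [m] column vectors: the
    subspaces transverse to [C] are the graphs of matrices, to which
    positivity applies. Summing over all [C], a pair of subspaces whose sum has
    dimension [m + e] is counted with a multiplicity proportional to [1 / w e]
    for [w = transverse_weight]; so with this weight every ordered pair of
    distinct members contributes the same negative amount, and the bound is
    [al], which is a Gaussian binomial coefficient.

    The function [g] is the Fourier transform of a function of the rank whose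
    values are obtained by Newton interpolation at the powers of [q]. They are
    non-negative because the interpolated sequence grows at least by the factor
    [q ^ N] at each step, and this is where [m <= N], that is [2 * m <= n], is
    needed. *)

(** * Counting matrices by rank *)

Section RankSums.
Variables (F : finFieldType) (R : numFieldType).
Let q : R := #|F|%:R.

Lemma sum_col_mx (a b N : nat) (G : 'M[F]_(a + b, N) -> R) :
  \sum_X G X = \sum_(Y : 'M[F]_(b, N)) \sum_(y : 'M[F]_(a, N)) G (col_mx y Y).
Proof.
rewrite exchange_big pair_big /=.
rewrite (reindex (fun z : 'M[F]_(a, N) * 'M[F]_(b, N) => col_mx z.1 z.2)) //=.
exists (fun X => (usubmx X, dsubmx X)) => [[y Y]|X] _ /=.
  by rewrite col_mxKu col_mxKd.
by rewrite vsubmxK.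
Qed.

Lemma card_submx_row b N (B : 'M[F]_(b, N)) :
  #|[pred y : 'rV[F]_N | (y <= B)%MS]| = (#|F| ^ \rank B)%N.
Proof. by rewrite -card_rowg; apply: eq_card => y; rewrite inE mem_rowg. Qed.

Lemma rank_adds_row b N (B : 'M[F]_(b, N)) (y : 'rV[F]_N) :
  \rank (y + B)%MS = (~~ (y <= B)%MS + \rank B)%N.
Proof.
have [yB | nyB] := boolP (y <= B)%MS.
  by rewrite (addsmx_idPr yB).
apply/eqP; rewrite add1n eqn_leq; apply/andP; split.
  apply: leq_trans (mxrank_adds_leqif _ _) _.
  by apply: (@leq_add _ _ 1) => //; apply: rank_leq_row.
rewrite (ltn_leqif (mxrank_leqif_sup (addsmxSr y B))).
by rewrite addsmx_sub submx_refl andbT.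
Qed.

Lemma sum_adds_row (phi : nat -> R) b N (B : 'M[F]_(b, N)) :
  \sum_(y : 'rV[F]_N) phi (\rank (y + B)%MS) =
  q ^+ \rank B * phi (\rank B)
  + (q ^+ N - q ^+ \rank B) * phi (\rank B).+1.
Proof.
rewrite (bigID [pred y : 'rV[F]_N | (y <= B)%MS]) /=.
under eq_bigr => y yB do rewrite rank_adds_row yB add0n.
under [X in _ + X]eq_bigr => y yB do rewrite rank_adds_row yB add1n.
rewrite !sumr_const card_submx_row.
have := cardC [pred y : 'rV[F]_N | (y <= B)%MS].
rewrite card_submx_row card_mx mul1n => card_eq.
rewrite -[X in X + _]mulr_natl natrX -[X in _ + X]mulr_natl; congr (_ + _ * _).
have -> : q ^+ N = (#|F| ^ N)%:R by rewrite natrX.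
rewrite -card_eq natrD natrX addrAC subrr add0r.
by congr (_%:R); apply: eq_card => y; rewrite !inE.
Qed.

(** The effect of one more row: it lies in the span of the [j] independent rows
    above it in [q ^ j] cases, and raises the rank in the others. *)
Definition rank_step (N : nat) (phi : nat -> R) (j : nat) : R :=
  q ^+ j * phi j + (q ^+ N - q ^+ j) * phi j.+1.

Lemma sum_addsS (phi : nat -> R) v b N (B : 'M[F]_(b, N)) :
  \sum_(Y : 'M[F]_(v.+1, N)) phi (\rank (Y + B)%MS) =
  \sum_(Y : 'M[F]_(v, N)) rank_step N phi (\rank (Y + B)%MS).
Proof.
rewrite (@sum_col_mx 1 v) /=; apply: eq_bigr => Y _.
rewrite /rank_step -sum_adds_row; apply: eq_bigr => y _; congr phi.
by rewrite addsmxA (adds_eqmx (addsmxE y Y) (eqmx_refl B)).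
Qed.

Definition rank_sum (v N : nat) (phi : nat -> R) : R :=
  \sum_(X : 'M[F]_(v, N)) phi (\rank X).

Lemma rank_sumE v N phi :
  rank_sum v N phi =
  \sum_(X : 'M[F]_(v, N)) phi (\rank (X + (0 : 'M_(0, N)))%MS).
Proof. by apply: eq_bigr => X _; rewrite addsmx0. Qed.

Lemma rank_sumS v N phi :
  rank_sum v.+1 N phi = rank_sum v N (rank_step N phi).
Proof. by rewrite !rank_sumE sum_addsS. Qed.

Lemma rank_sum0 N phi : rank_sum 0 N phi = phi 0.
Proof.
rewrite /rank_sum (big_pred1 0) => [|X]; first by rewrite mxrank0.
by apply/esym/eqP; rewrite [X]flatmx0 [RHS]flatmx0.
Qed.

Lemma eq_rank_sum v N (phi psi : nat -> R) :
  (forall j, (j <= v)%N -> phi j = psi j) ->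
  rank_sum v N phi = rank_sum v N psi.
Proof. by move=> e; apply: eq_bigr => X _; rewrite e // rank_leq_row. Qed.

(** Each new row has to avoid the span of the previous ones. *)
Lemma card_adds_free v b N (B : 'M[F]_(b, N)) :
  #|[set Y : 'M[F]_(v, N) | \rank (Y + B)%MS == (v + \rank B)%N]|%:R =
  \prod_(l < v) (q ^+ N - q ^+ (\rank B + l)) :> R.
Proof.
pose phi (c j : nat) : R := (j == c)%:R.
have -> : #|[set Y : 'M[F]_(v, N) | \rank (Y + B)%MS == (v + \rank B)%N]|%:R =
    \sum_(Y : 'M[F]_(v, N)) phi (v + \rank B)%N (\rank (Y + B)%MS) :> R.
  rewrite -sum1_card natr_sum big_mkcond; apply: eq_bigr => Y _.
  by rewrite inE /phi; case: eqP.
elim: v => [|v IHv].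
  rewrite big_ord0 (big_pred1 0) => [|X]; last first.
    by apply/esym/eqP; rewrite [X]flatmx0 [RHS]flatmx0.
  by rewrite adds0mx /phi eqxx.
rewrite sum_addsS big_ord_recr /= -IHv mulr_suml; apply: eq_bigr => Y _.
rewrite /rank_step /phi.
have le: (\rank (Y + B)%MS <= v + \rank B)%N.
  by apply: leq_trans (mxrank_adds_leqif _ _) _; rewrite leq_add2r rank_leq_row.
rewrite (ltn_eqF (_ : _ < v.+1 + _)%N) // mulr0 add0r addSn eqSS.
by case: eqP => [->|_]; rewrite ?mulr0 ?mul0r // mulr1 mul1r addnC.
Qed.

Lemma card_row_free v N :
  #|[set Y : 'M[F]_(v, N) | row_free Y]|%:R =
  \prod_(l < v) (q ^+ N - q ^+ l) :> R.
Proof.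
transitivity (#|[set Y : 'M[F]_(v, N) |
   \rank (Y + (0 : 'M_(0, N)))%MS ==
   (v + \rank (0%R : 'M[F]_(0, N)))%N]|%:R : R).
  congr _%:R; apply: eq_card => Y.
  by rewrite !inE addsmx0 mxrank0 addn0.
by rewrite card_adds_free; apply: eq_bigr => l _; rewrite mxrank0 add0n.
Qed.

Lemma q_gt1 : 1 < q.
Proof. by rewrite ltr1n finNzRing_gt1. Qed.

Lemma q_gt0 : 0 < q. Proof. exact: lt_trans q_gt1. Qed.

Lemma row_free_count_gt0 v N : (v <= N)%N ->
  0 < \prod_(l < v) (q ^+ N - q ^+ l).
Proof.
move=> vN; apply: prodr_gt0 => l _; rewrite subr_gt0 ltr_eXn2l ?q_gt1 //.
by apply: leq_trans vN.
Qed.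

(** The system is triangular: among the matrices with [l] rows those of rank
    [l] occur, and the others only involve values already known to vanish. *)
Lemma rank_sum_eq0 u N (phi : nat -> R) : (u <= N)%N ->
  (forall i, (i <= u)%N -> rank_sum i N phi = 0) ->
  forall l, (l <= u)%N -> phi l = 0.
Proof.
move=> uN sum0; elim/ltn_ind => l IHl lu.
have := sum0 l lu; rewrite /rank_sum.
rewrite (bigID [pred Y : 'M[F]_(l, N) | row_free Y]) /= addrC big1 ?add0r.
  rewrite (eq_bigr (fun=> phi l)) => [|Y /eqP -> //].
  rewrite sumr_const -mulr_natl => /eqP; rewrite mulf_eq0.
  have -> : #|[pred Y : 'M[F]_(l, N) | row_free Y]| =
            #|[set Y : 'M[F]_(l, N) | row_free Y]|.
    by apply: eq_card => Y; rewrite !inE.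
  rewrite card_row_free gt_eqF ?row_free_count_gt0 ?(leq_trans lu) //=.
  by move/eqP.
move=> Y nfree; have lt : (\rank Y < l)%N.
  by rewrite ltn_neqAle nfree rank_leq_row.
by apply: IHl => //; apply: leq_trans (ltnW lt) lu.
Qed.

Lemma rank_sum_ge0 v N phi : (forall j, 0 <= phi j) -> 0 <= rank_sum v N phi.
Proof. by move=> p0; apply: sumr_ge0. Qed.

Lemma le_rank_sum N phi u v : (forall j, 0 <= phi j) -> (u <= v)%N ->
  rank_sum u N phi <= rank_sum v N phi.
Proof.
move=> p0; move: u v.
apply: (@homo_leq _ (fun u => rank_sum u N phi) <=%R) => [//|? ? ?|v].
  exact: le_trans.
rewrite rank_sumS /rank_sum; apply: ler_sum => X _; rewrite /rank_step.
have qj1 j : 1 <= q ^+ j by rewrite exprn_ege1 // ltW ?q_gt1.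
rewrite -[leLHS]addr0 lerD //; first by rewrite ler_peMl.
by rewrite mulr_ge0 // subr_ge0 ler_weXn2l ?rank_leq_col // ltW ?q_gt1.
Qed.

End RankSums.
(** * Newton interpolation at powers of q *)

Section QDifferences.
Variables (R : numFieldType) (q : R).

(** [qdiff f l 0] is the [l]-th coefficient of [f] in the basis of Gaussian
    binomials: the shift operator [E] enters through the product of the
    [E - q ^ i] for [i < l]. *)
Fixpoint qdiff (f : nat -> R) (l v : nat) : R :=
  if l is l'.+1 then qdiff f l' v.+1 - q ^+ l' * qdiff f l' v else f v.

Lemma geometric_sum_le k : 2 <= q -> \sum_(b < k) q ^+ b <= q ^+ k.
Proof.
move=> q2; have q0 : 0 <= q by apply: le_trans q2; rewrite ler0n.
elim: k => [|k IHk]; first by rewrite big_ord0 ler01.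
rewrite big_ord_recr /= exprS; apply: le_trans (lerD IHk (lexx _)) _.
by rewrite -mulr2n -mulr_natl ler_wpM2r // exprn_ge0.
Qed.

(** A non-negative sequence growing at least by the factor [K >= q ^ l] has a
    difference [E f - q ^ l * f] growing at least by [K - q ^ l]. After [l]
    steps the factor is still [q ^ N - (1 + q + ... + q ^ (l - 1))], and it is
    non-negative as long as [l <= N]. *)
Lemma qdiff_ge0 N f : 2 <= q -> (forall v, 0 <= f v) ->
    (forall v, q ^+ N * f v <= f v.+1) ->
  forall l v, (l <= N)%N ->
  0 <= qdiff f l v /\
  (q ^+ N - \sum_(b < l) q ^+ b) * qdiff f l v <= qdiff f l v.+1.
Proof.
move=> q2 f0 fN; have q0 : 0 <= q by apply: le_trans q2; rewrite ler0n.
elim=> [|l IHl] v lN; first by rewrite big_ord0 subr0.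
have {}IHl v := IHl v (ltnW lN).
have Kge0 : 0 <= q ^+ N - \sum_(b < l.+1) q ^+ b.
  rewrite subr_ge0; apply: le_trans (geometric_sum_le _ q2) _.
  by rewrite ler_weXn2l //; apply: le_trans q2; rewrite ler1n.
have step u : (q ^+ N - \sum_(b < l.+1) q ^+ b) * qdiff f l u <= qdiff f l.+1 u.
  rewrite /= lerBrDr; apply: le_trans (proj2 (IHl u)).
  by rewrite -mulrDl big_ord_recr /= opprD addrA subrK.
have pos u : 0 <= qdiff f l.+1 u.
  by apply: le_trans (step u); rewrite mulr_ge0 //; case: (IHl u).
split=> //; apply: le_trans (step v.+1); rewrite ler_wpM2l //=.
by rewrite gerBl mulr_ge0 ?exprn_ge0 //; case: (IHl v).
Qed.

End QDifferences.

Section QNewton.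
Variables (F : finFieldType) (R : numFieldType) (N : nat) (f : nat -> R).
Let q : R := #|F|%:R.

(** The denominator counts the matrices of rank [j] with a given column space of
    dimension [j], so that [newton_coef] is the value at a single matrix. *)
Definition newton_coef (j : nat) : R :=
  qdiff q f j 0 / \prod_(l < j) (q ^+ N - q ^+ l).

(** With these denominators [rank_step] acts on the coefficients as
    [q ^ j * qdiff f j u + qdiff f j.+1 u = qdiff f j u.+1], i.e. as the shift
    of [f]. *)
Lemma rank_sum_qdiff v u : (v <= N)%N ->
  rank_sum F v N (fun j => qdiff q f j u / \prod_(l < j) (q ^+ N - q ^+ l))
  = f (v + u)%N.
Proof.
elim: v u => [|v IHv] u vN; first by rewrite rank_sum0 big_ord0 divr1.
rewrite rank_sumS addSnnS -IHv ?(ltnW vN) //.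
apply: eq_rank_sum => j jv; rewrite /rank_step big_ord_recr /= -/q.
have jN := leq_ltn_trans jv vN.
have nz : q ^+ N - q ^+ j != 0.
  by rewrite subr_eq0 gt_eqF // ltr_eXn2l ?q_gt1.
have nzP : \prod_(l < j) (q ^+ N - q ^+ l) != 0.
  by rewrite gt_eqF // row_free_count_gt0 // ltnW.
by field; rewrite nzP nz.
Qed.

Lemma rank_sum_newton v : (v <= N)%N -> rank_sum F v N newton_coef = f v.
Proof. by move=> vN; rewrite rank_sum_qdiff // addn0. Qed.

Lemma newton_coef_ge0 j : (forall v, 0 <= f v) ->
  (forall v, q ^+ N * f v <= f v.+1) -> 0 <= newton_coef j.
Proof.
move=> f0 fN; rewrite /newton_coef; have [jN|Nj] := leqP j N.
  rewrite divr_ge0 //; last by rewrite ltW // row_free_count_gt0.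
  have q2 : 2 <= q by rewrite ler_nat finNzRing_gt1.
  by have [] := qdiff_ge0 q2 f0 fN 0 jN.
(* Beyond [N] the denominator vanishes, and so does the quotient. *)
by rewrite (bigD1 (Ordinal Nj)) //= subrr mul0r invr0 mulr0.
Qed.

End QNewton.

(** * Positive definite functions of the rank *)

Lemma rank_castmx (F : fieldType) m m' N (e : m = m') (X : 'M[F]_(m, N)) :
  \rank (castmx (e, erefl N) X) = \rank X.
Proof. by case: _ / e; rewrite castmx_id. Qed.

Section RankKernels.
Variables (F : finFieldType) (psi : F -> algC).
Hypothesis psiD : forall x y, psi (x + y) = psi x * psi y.
Hypothesis psiN : forall x, psi (- x) = (psi x)^*.
Hypothesis psi0 : psi 0 = 1.
Hypothesis psi_nontriv : exists x, psi x != 1.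
Let q : algC := #|F|%:R.

Lemma mxtrace_mul_trE m N (X Y : 'M[F]_(m, N)) :
  \tr (X *m Y^T) = \sum_i \sum_j X i j * Y i j.
Proof.
by apply: eq_bigr => i _; rewrite mxE; apply: eq_bigr => j _; rewrite mxE.
Qed.

Lemma psi_sum_eq0 m N (Y : 'M[F]_(m, N)) :
  \sum_(X : 'M[F]_(m, N)) psi (\tr (X *m Y^T)) =
  (Y == 0)%:R * q ^+ (m * N).
Proof.
have [->|nzY] := eqVneq Y 0.
  under eq_bigr => X _ do rewrite trmx0 mulmx0 mxtrace0 psi0.
  by rewrite sumr_const card_mx natrX mul1r.
have /existsP[i /existsP[j nzYij]] : [exists i, exists j, Y i j != 0].
  apply: contraNT nzY; rewrite negb_exists => /forallP z.
  apply/eqP/matrixP => i j; rewrite mxE; have := z i.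
  by rewrite negb_exists => /forallP/(_ j)/negPn/eqP.
have [a a1] := psi_nontriv.
pose X0 : 'M[F]_(m, N) := (a / Y i j) *: delta_mx i j.
have trX0 : \tr (X0 *m Y^T) = a.
  rewrite mxtrace_mul_trE (bigD1 i) //= (bigD1 j) //= !mxE !eqxx /= mulr1.
  rewrite divfK //.
  rewrite !big1 ?addr0 // => [i' /negPf ni|j' /negPf nj].
    by apply: big1 => j' _; rewrite !mxE ni mulr0 mul0r.
  by rewrite !mxE nj andbF mulr0 mul0r.
have : \sum_(X : 'M[F]_(m, N)) psi (\tr (X *m Y^T)) =
       psi a * \sum_(X : 'M[F]_(m, N)) psi (\tr (X *m Y^T)).
  rewrite {1}(reindex_inj (addrI X0)) mulr_sumr; apply: eq_bigr => X _.
  by rewrite mulmxDl mxtraceD psiD trX0.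
move/eqP; rewrite -subr_eq0 -{1}[X in X - _]mul1r -mulrBl mulf_eq0 subr_eq0.
by rewrite eq_sym (negPf a1) mul0r => /eqP.
Qed.

(** The Fourier transform of [a (\rank Y)], for the pairing [\tr (X *m Y^T)]. *)
Definition rank_kernel m N (a : nat -> algC) (X : 'M[F]_(m, N)) : algC :=
  \sum_(Y : 'M[F]_(m, N)) a (\rank Y) * psi (\tr (X *m Y^T)).

Definition positive_definite (V : zmodType) (g : V -> algC) : Prop :=
  forall (I : finType) (E : {set I}) (x : I -> V),
    0 <= \sum_(i in E) \sum_(j in E) g (x i - x j).

(** The double sum is that of the [a (\rank Y)] times the squared modulus of an
    exponential sum over the points. *)
Lemma rank_kernel_posdef m N a : (forall j, 0 <= a j) ->
  positive_definite (@rank_kernel m N a).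
Proof.
move=> a0 I E x.
pose S Y := \sum_(i in E) psi (\tr (x i *m Y^T)).
suff -> : \sum_(i in E) \sum_(j in E) rank_kernel a (x i - x j) =
          \sum_Y a (\rank Y) * (S Y * (S Y)^*).
  by apply: sumr_ge0 => Y _; rewrite mulr_ge0 // mul_conjC_ge0.
rewrite /rank_kernel; under eq_bigr => i _ do rewrite exchange_big /=.
rewrite exchange_big /=; apply: eq_bigr => Y _.
rewrite /S rmorph_sum /= big_distrlr /= mulr_sumr; apply: eq_bigr => i _.
rewrite mulr_sumr; apply: eq_bigr => j _.
by rewrite mulmxBl raddfB psiD psiN.
Qed.

(** The adjoint substitution [Y := P^T *m Y *m Q^T] preserves the rank. *)
Lemma rank_kernel_unit m N a (X : 'M[F]_(m, N)) P Q :
  P \in unitmx -> Q \in unitmx ->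
  rank_kernel a (P *m X *m Q) = rank_kernel a X.
Proof.
move=> uP uQ; have uPT : P^T \in unitmx by rewrite unitmx_tr.
have uQT : Q^T \in unitmx by rewrite unitmx_tr.
rewrite [RHS](reindex (fun Y => P^T *m Y *m Q^T)) /=; last first.
  exists (fun Y => invmx P^T *m Y *m invmx Q^T) => Y _.
    by rewrite -!mulmxA mulKmx // mulmxV // mulmx1.
  by rewrite -!mulmxA mulVmx // mulmx1 mulKVmx.
apply: eq_bigr => Y _; congr (a _ * psi _).
  by rewrite mxrankMfree ?row_free_unit // eqmxMfull // row_full_unit.
by rewrite !trmx_mul !trmxK !mulmxA -!mulmxA mxtrace_mulC !mulmxA.
Qed.

Lemma rank_kernel_rank m N a (X X' : 'M[F]_(m, N)) :
  \rank X = \rank X' -> rank_kernel a X = rank_kernel a X'.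
Proof.
move=> eqr; rewrite -[X]mulmx_ebase -[X']mulmx_ebase eqr.
by rewrite !rank_kernel_unit ?row_ebase_unit ?col_ebase_unit.
Qed.

Lemma rank_kernel_castmx m m' N a (e : m = m') (X : 'M[F]_(m, N)) :
  rank_kernel a (castmx (e, erefl) X) = rank_kernel a X.
Proof. by case: _ / e; rewrite castmx_id. Qed.

(** Poisson summation over the subgroup of the matrices whose last [i'] rows
    vanish; its annihilator consists of those whose first [i] rows vanish. *)
Lemma sum_rank_kernel i i' N a :
  \sum_(X : 'M[F]_(i, N)) rank_kernel a (col_mx X (0 : 'M_(i', N))) =
  q ^+ (i * N) * rank_sum F i' N a.
Proof.
rewrite exchange_big sum_col_mx /= mulr_sumr; apply: eq_bigr => Yd _.
rewrite (bigD1 0) //= [X in _ + X]big1 ?addr0 => [|Yu nz].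
  rewrite -mulr_sumr rank_col_0mx mulrC; congr (_ * _).
  rewrite (eq_bigr (fun=> 1)) ?sumr_const ?card_mx ?natrX // => X _.
  rewrite tr_col_mx mul_col_row mul0mx trmx0 mulmx0 mxtrace_block.
  by rewrite !mul0mx !mxtrace0 addr0 psi0.
rewrite -mulr_sumr; under eq_bigr => X _.
  rewrite tr_col_mx mul_col_row !mul0mx mxtrace_block mxtrace0 addr0.
  over.
by rewrite psi_sum_eq0 (negPf nz) mul0r mulr0.
Qed.

End RankKernels.

(** The common source of both extremal bounds over the field. The prescribed
    values of [g] on ranks at most [m - d], together with a Fourier transform
    supported on ranks above [d], determine by Poisson summation the sums of the
    transform over the matrices with [v] rows, for every [v]: these sums are the
    [f v] below, and Newton interpolation recovers the transform from them. *)
Lemma exists_posdef_kernel (F : finFieldType) (psi : F -> algC) :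
    (forall x y, psi (x + y) = psi x * psi y) ->
    (forall x, psi (- x) = (psi x)^*) ->
    psi 0 = 1 -> (exists x, psi x != 1) ->
  forall (m N d : nat) (w : nat -> algC),
    (d <= m)%N -> (m <= N)%N -> (forall j, 0 <= w j) ->
  exists2 g : 'M[F]_(m, N) -> algC, positive_definite g &
    forall X, (\rank X <= m - d)%N ->
      g X = (X == 0)%:R * rank_sum F (m - d) N w - w (\rank X).
Proof.
move=> psiD psiN psi0 psi_nt m N d w dm mN w0.
pose q : algC := #|F|%:R; have q0 : 0 < q := q_gt0 F _.
pose al := rank_sum F (m - d) N w.
pose f v : algC := if (v < d)%N then 0 else
  q ^+ (N * v) * (al - rank_sum F (m - v) N w).
have f0 v : 0 <= f v.
  rewrite /f; case: ltnP => // dv; rewrite mulr_ge0 ?exprn_ge0 ?(ltW q0) //.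
  by rewrite subr_ge0 le_rank_sum // leq_sub2l.
have fN v : q ^+ N * f v <= f v.+1.
  rewrite {1}/f; case: ltnP => [_|dv]; first by rewrite mulr0.
  rewrite /f ltnNge (leq_trans dv) //= mulrA -exprD mulnS.
  rewrite ler_wpM2l ?exprn_ge0 ?(ltW q0) // lerB // le_rank_sum //.
  by rewrite leq_sub2l.
pose a := newton_coef F N f.
have a0 j : 0 <= a j by apply: newton_coef_ge0.
pose g (X : 'M[F]_(m, N)) := (q ^+ (N * m))^-1 * rank_kernel psi a X.
exists g.
  move=> I E x; have := rank_kernel_posdef psiD psiN a0 E x.
  move=> /(mulr_ge0 (_ : 0 <= (q ^+ (N * m))^-1)) ge0.
  rewrite (le_trans (ge0 _)) ?invr_ge0 ?exprn_ge0 ?(ltW q0) //.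
  rewrite mulr_sumr ler_sum // => i _; by rewrite mulr_sumr.
(* [g] depends on the rank only, so it is enough to compare its values with the
   prescribed ones after summation over all matrices with [i] rows. *)
pose phi l := g (pid_mx l) - ((l == 0)%:R * al - w l).
have phi0 : forall l, (l <= m - d)%N -> phi l = 0.
  apply: (@rank_sum_eq0 F _ _ N); first exact: leq_trans (leq_subr _ _) mN.
  move=> i imd; have im : (i <= m)%N := leq_trans imd (leq_subr _ _).
  rewrite /rank_sum /phi !sumrB /=.
  have -> : \sum_(X : 'M[F]_(i, N)) (\rank X == 0)%:R * al = al.
    rewrite (bigD1 0) //= mxrank0 eqxx mul1r big1 ?addr0 // => X nz.
    by rewrite mxrank_eq0 (negPf nz) mul0r.
  have -> : \sum_(X : 'M[F]_(i, N)) g (pid_mx (\rank X)) =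
            al - rank_sum F i N w; last by rewrite subrr.
  rewrite /g -mulr_sumr.
  have [i' mE] : exists i', m = (i + i')%N by exists (m - i)%N; rewrite subnKC.
  have rg X : rank_kernel psi a (pid_mx (\rank X) : 'M_(m, N)) =
    rank_kernel psi a (castmx (esym mE, erefl) (col_mx X (0 : 'M_(i', N)))).
    apply: rank_kernel_rank => //.
    rewrite rank_pid_mx ?(leq_trans (rank_leq_row _)) ?(leq_trans im) //.
    by rewrite rank_castmx rank_col_mx0.
  under eq_bigr => X _ do rewrite rg.
  have -> : \sum_X rank_kernel psi a
       (castmx (esym mE, erefl) (col_mx X (0 : 'M_(i', N)))) =
     q ^+ (i * N) * rank_sum F i' N a.
    rewrite -(sum_rank_kernel psiD psi0 psi_nt); apply: eq_bigr => X _.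
    exact: rank_kernel_castmx.
  rewrite rank_sum_newton; last by apply: leq_trans mN; rewrite mE leq_addl.
  rewrite /f ltnNge; have -> : (d <= i')%N by lia.
  have -> : (m - i' = i)%N by lia.
  have -> : q ^+ (N * m) = q ^+ (i * N) * q ^+ (N * i').
    by rewrite -exprD mE mulnDr mulnC.
  by rewrite [X in _^-1 * X]mulrA mulKf // gt_eqF // mulr_gt0 ?exprn_gt0.
move=> X Xmd; have := phi0 _ Xmd; rewrite /phi mxrank_eq0 => /eqP.
rewrite subr_eq0 => /eqP <-; rewrite /g; congr (_ * _).
apply: rank_kernel_rank => //; rewrite rank_pid_mx //.
  exact: rank_leq_row.
exact: rank_leq_col.
Qed.
(** * Rank-metric anticodes over a prime field *)

Lemma Fp_character p : prime p -> exists psi : 'F_p -> algC,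
  [/\ forall x y, psi (x + y) = psi x * psi y,
      forall x, psi (- x) = (psi x)^*, psi 0 = 1 & exists x, psi x != 1].
Proof.
move=> p_pr; have [z zp] := C_prim_root_exists (prime_gt0 p_pr).
pose psi (x : 'F_p) := z ^+ x.
have psiD x y : psi (x + y) = psi x * psi y.
  have eq_mod k : (k %% (Zp_trunc (pdiv p)).+2 = k %% p)%N by rewrite Fp_cast.
  by rewrite /psi -exprD /= eq_mod prim_expr_mod.
have psi0 : psi 0 = 1 by [].
have norm_z : `|z| = 1.
  apply/eqP; rewrite -(@pexpr_eq1 _ _ p) ?prime_gt0 //.
  by rewrite -normrX prim_expr_order // normr1.
exists psi; split=> // [x|].
  have : psi x * psi (- x) = 1 by rewrite -psiD subrr.
  have : psi x * (psi x)^* = 1 by rewrite -normCK normrX norm_z !expr1n.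
  by move=> <-; apply: mulfI; rewrite expf_neq0 // -normr_eq0 norm_z oner_eq0.
exists 1; rewrite /psi /= expr1.
apply/eqP => z1; have := prim_order_dvd zp 1; rewrite z1 expr1n eqxx.
by rewrite dvdn1 => /eqP p1; rewrite p1 in p_pr.
Qed.

(** The double sum is [#|E| * (c - #|E|)]. *)
Lemma natr_le_of_sum_ge0 (I : finType) (E : {set I}) (c : algC) : 0 <= c ->
  0 <= \sum_(i in E) \sum_(j in E) ((i == j)%:R * c - 1) -> #|E|%:R <= c.
Proof.
move=> c0; rewrite (eq_bigr (fun=> c - #|E|%:R)) => [|i iE].
  rewrite sumr_const -[X in 0 <= X]mulr_natl; have [->//|nz] := posnP #|E|.
  by rewrite pmulr_rge0 ?ltr0n // subr_ge0.
rewrite sumrB sumr_const; congr (_ - _).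
rewrite (bigD1 i) //= eqxx mul1r big1 ?addr0 // => j /andP[_ /negPf nji].
by rewrite eq_sym nji mul0r.
Qed.

(** The constant weight [1]: each pair of distinct matrices contributes [-1] to
    a non-negative sum, and each diagonal pair [q ^ (u * N) - 1]. *)
Theorem card_rank_metric_anticode p m N u (I : finType) (E : {set I})
    (x : I -> 'M['F_p]_(m, N)) : prime p -> (m <= N)%N -> (u <= m)%N ->
    {in E &, injective x} ->
    {in E &, forall i j, (\rank (x i - x j)%R <= u)%N} ->
  (#|E| <= p ^ (u * N))%N.
Proof.
move=> p_pr mN um injx rk_le.
have [psi [psiD psiN psi0 psi_nt]] := Fp_character p_pr.
have [g g_pd gE] := exists_posdef_kernel psiD psiN psi0 psi_nt
  (leq_subr u m) mN (fun=> ler01).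
rewrite subKn // in gE.
have alE : rank_sum 'F_p u N (fun=> 1) = (p ^ (u * N))%:R :> algC.
  by rewrite /rank_sum sumr_const card_mx card_Fp.
rewrite -(ler_nat algC); apply: natr_le_of_sum_ge0 => //.
have := g_pd _ E x; congr (0 <= _); apply: eq_bigr => i iE.
apply: eq_bigr => j jE; rewrite gE ?rk_le // alE subr_eq0.
by rewrite (inj_in_eq injx).
Qed.

(** * Frames transverse to two subspaces *)

Lemma rank_block1 (F : fieldType) m n k (a : 'M[F]_(m, n)) (c : 'M[F]_(k, m))
    (b : 'M[F]_(k, n)) :
  \rank (block_mx 1%:M a c b) = (m + \rank (b - c *m a)%R)%N.
Proof.
have := rank_diag_block_mx (1%:M : 'M[F]_m) (b - c *m a); rewrite mxrank1 => <-.
have <- : block_mx 1%:M 0 (- c) 1%:M *m block_mx 1%:M a c b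
          *m block_mx 1%:M (- a) 0 1%:M = block_mx 1%:M 0 0 (b - c *m a).
  rewrite !mulmx_block !mulmx1 !mul1mx !mul0mx !mulmx0 !addr0.
  rewrite !addNr mul0mx add0r mul1mx addNr mulNmx.
  by rewrite [X in block_mx _ _ _ X]addrC.
rewrite mxrankMfree; last first.
  by rewrite row_free_unit unitmxE det_ublock !det1 mulr1 unitr1.
by rewrite eqmxMfull // row_full_unit unitmxE det_lblock !det1 mulr1 unitr1.
Qed.

Section FrameCount.
Variables (F : finFieldType).
Let q : algC := #|F|%:R.

Lemma row_free_completion m N (x : 'M[F]_(m, m + N)) : row_free x ->
  exists2 G, G \in unitmx & x *m G = row_mx 1%:M 0.
Proof.
move=> /eqP rx; have := mulmx_ebase x; rewrite rx.
set L := col_ebase x; set R := row_ebase x => xE.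
have uL : L \in unitmx := col_ebase_unit x.
have uR : R \in unitmx := row_ebase_unit x.
exists (invmx R *m block_mx (invmx L) 0 0 1%:M).
  rewrite unitmx_mul unitmx_inv uR unitmxE det_ublock det1 mulr1 -unitmxE.
  by rewrite unitmx_inv.
rewrite -xE mulmxA mulmxK // pid_mx_row mul_mx_row mulmx1 mulmx0.
by rewrite mul_row_block !mulmx0 !mul0mx !addr0 mulmxV.
Qed.

(** The last [e'] rows of [P + pid_mx e *m Y] are those of [P] and the first [e]
    ones are arbitrary, so this counts the completions of [e'] independent rows
    to a basis. *)
Lemma count_pid_aux e e' e'' (P : 'M[F]_(e + e')) :
  row_free (row_mx P (pid_mx e : 'M_(e + e', e + e''))) ->
  \sum_(Y : 'M[F]_(e + e'', e + e')) (P + pid_mx e *m Y \in unitmx)%:R =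
  q ^+ (e'' * (e + e')) * \prod_(l < e) (q ^+ (e + e') - q ^+ (e' + l)) :> algC.
Proof.
move=> freeP; have freePd : \rank (dsubmx P) = e'.
  apply/eqP; rewrite eqn_leq rank_leq_row -(leq_add2l e).
  move: freeP; rewrite -row_leq_rank => /leq_trans; apply.
  have -> : row_mx P (pid_mx e : 'M_(e + e', e + e'')) =
      col_mx (row_mx (usubmx P) (row_mx 1%:M 0)) (row_mx (dsubmx P) 0).
    by rewrite -{1}[P]vsubmxK pid_mx_block block_mxEv row_mx0 -block_mxEh.
  rewrite -addsmxE (leq_trans (mxrank_adds_leqif _ _)) //.
  by rewrite rank_row_mx0 leq_add2r rank_leq_row.
rewrite sum_col_mx.
rewrite (eq_bigr (fun=> \prod_(l < e) (q ^+ (e + e') - q ^+ (e' + l)))).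
  by rewrite sumr_const card_mx -[LHS]mulr_natl natrX.
move=> Y2 _; have := card_adds_free algC e (dsubmx P); rewrite freePd -/q => <-.
rewrite -sum1_card natr_sum [RHS]big_mkcond.
rewrite [RHS](reindex_inj (addrI (usubmx P))); apply: eq_bigr => Y1 _.
rewrite pid_mx_block mul_block_col !mul0mx mul1mx !addr0 -{1}[P]vsubmxK.
rewrite add_col_mx addr0 inE -row_free_unit /row_free addsmxE.
by case: eqP.
Qed.

Lemma count_pid m N e (P : 'M[F]_m) : (e <= m)%N -> (e <= N)%N ->
  row_free (row_mx P (pid_mx e : 'M_(m, N))) ->
  \sum_(Y : 'M[F]_(N, m)) (P + pid_mx e *m Y \in unitmx)%:R =
  q ^+ ((N - e) * m) * \prod_(l < e) (q ^+ m - q ^+ (m - e + l)) :> algC.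
Proof.
move=> em eN; have [e' mE] : exists e', m = (e + e')%N.
  by exists (m - e)%N; rewrite subnKC.
have [e'' NE] : exists e'', N = (e + e'')%N by exists (N - e)%N; rewrite subnKC.
by subst m N => free; rewrite count_pid_aux // !addKn.
Qed.

(** The count is invariant under row and column operations on [Q], which reduce
    it to [pid_mx (\rank Q)]. *)
Lemma count_pencil_units m N (P : 'M[F]_m) (Q : 'M[F]_(m, N)) :
  row_free (row_mx P Q) ->
  \sum_(Y : 'M[F]_(N, m)) (P + Q *m Y \in unitmx)%:R =
  q ^+ ((N - \rank Q) * m) *
  \prod_(l < \rank Q) (q ^+ m - q ^+ (m - \rank Q + l)) :> algC.
Proof.
move=> free; pose L := col_ebase Q; pose R := row_ebase Q; set e := \rank Q.
have uL : L \in unitmx := col_ebase_unit Q.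
have uR : R \in unitmx := row_ebase_unit Q.
have QE : Q = L *m pid_mx e *m R by rewrite mulmx_ebase.
rewrite -(@count_pid m N e (invmx L *m P)) ?rank_leq_row ?rank_leq_col //.
  rewrite [RHS](reindex (mulmx R)) /=; last first.
    by exists (mulmx (invmx R)) => Y _; rewrite ?mulKmx ?mulKVmx.
  apply: eq_bigr => Y _; congr (_%:R); congr nat_of_bool.
  have -> : P + Q *m Y = L *m (invmx L *m P + pid_mx e *m (R *m Y)).
    by rewrite mulmxDr mulKVmx // QE !mulmxA.
  by rewrite unitmx_mul uL.
have -> : row_mx (invmx L *m P) (pid_mx e : 'M_(m, N)) =
    invmx L *m row_mx P Q *m block_mx 1%:M 0 0 (invmx R).
  rewrite mul_mx_row mul_row_block !mulmx0 mulmx1 addr0 add0r.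
  by rewrite QE !mulmxA mulVmx // mul1mx mulmxK.
rewrite /row_free mxrankMfree; last first.
  by rewrite row_free_unit unitmxE det_ublock det1 mul1r -unitmxE unitmx_inv.
by rewrite eqmxMfull // row_full_unit unitmx_inv.
Qed.

(** In coordinates where [x] is [(1 | 0)] and [y] is [(P | Q)], a frame
    [(C1 ; Y *m C1)] is transverse to both exactly when [C1] and [P + Q *m Y]
    are invertible, and the rank of [Q] is [e]. *)
Lemma count_transverse m N (x y : 'M[F]_(m, m + N)) e :
    row_free x -> row_free y -> \rank (x + y)%MS = (m + e)%N ->
  \sum_(C : 'M[F]_(m + N, m)) ((x *m C \in unitmx) && (y *m C \in unitmx))%:R =
  (\prod_(l < m) (q ^+ m - q ^+ l)) * (q ^+ ((N - e) * m) *
  \prod_(l < e) (q ^+ m - q ^+ (m - e + l))) :> algC.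
Proof.
move=> fx fy rxy; have [G uG xG] := row_free_completion fx.
pose P := lsubmx (y *m G); pose Q := rsubmx (y *m G).
have yG : y *m G = row_mx P Q by rewrite hsubmxK.
have fG : row_free G by rewrite row_free_unit.
have rQ : \rank Q = e.
  apply/eqP; rewrite -(eqn_add2l m) -rxy; apply/eqP.
  rewrite addsmxE -(mxrankMfree _ fG) mul_col_mx xG yG -block_mxEv rank_block1.
  by rewrite mulmx0 subr0.
have freePQ : row_free (row_mx P Q) by rewrite -yG /row_free mxrankMfree.
rewrite (reindex (mulmx G)) /=; last first.
  by exists (mulmx (invmx G)) => C _; rewrite ?mulKmx ?mulKVmx.
under eq_bigr => C _ do rewrite !mulmxA xG yG.
rewrite sum_col_mx exchange_big /=.
have := card_row_free F algC m m; rewrite -/q => <-.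
rewrite -sum1_card natr_sum mulr_suml [RHS]big_mkcond /=.
apply: eq_bigr => C1 _; rewrite inE row_free_unit mul1r.
under eq_bigr => C2 _ do rewrite !mul_row_col mul1mx mul0mx addr0.
have [uC1|] := boolP (C1 \in unitmx); last by rewrite big1.
rewrite -rQ -(count_pencil_units freePQ) (reindex (mulmx^~ C1)) /=; last first.
  by exists (mulmx^~ (invmx C1)) => C _ /=; rewrite ?mulmxK ?mulmxKV.
apply: eq_bigr => Y _; congr (_%:R); congr nat_of_bool.
by rewrite mulmxA -mulmxDl unitmx_mul uC1 andbT.
Qed.

End FrameCount.
(** * Intersecting families of subspaces over a prime field *)

Section TransverseWeight.
Variables (F : finFieldType).
Let q : algC := #|F|%:R.

(** The inverse of the proportion, among the frames transverse to an
    [m]-subspace, of those that are also transverse to a second one, when the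
    sum of the two has dimension [m + e]. *)
Definition transverse_weight (e : nat) : algC :=
  \prod_(b < e) (q ^+ b.+1 / (q ^+ b.+1 - 1)).

(** The Gaussian binomial coefficient [[N + u choose u]_q]. *)
Definition gauss (N u : nat) : algC :=
  \prod_(b < u) ((q ^+ (N + b).+1 - 1) / (q ^+ b.+1 - 1)).

Let qS_sub1_gt0 b : 0 < q ^+ b.+1 - 1.
Proof. by rewrite subr_gt0 exprn_egt1 // q_gt1. Qed.

Let qX_gt0 b : 0 < q ^+ b.
Proof. by rewrite exprn_gt0 // q_gt0. Qed.

Lemma transverse_weight_gt0 e : 0 < transverse_weight e.
Proof. by apply: prodr_gt0 => b _; rewrite divr_gt0. Qed.

Lemma transverse_weightE m N e : (e <= m)%N -> (e <= N)%N ->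
  q ^+ ((N - e) * m) * \prod_(l < e) (q ^+ m - q ^+ (m - e + l)) =
  q ^+ (N * m) / transverse_weight e.
Proof.
move=> em eN; rewrite -(subnK eN) addnK mulnDl exprD -mulrA; congr (_ * _).
rewrite /transverse_weight -prodfV mulnC exprM.
rewrite -[X in (q ^+ m) ^+ X](card_ord e) -prodr_const -big_split /=.
rewrite (reindex_inj rev_ord_inj) /=; apply: eq_bigr => b _.
have -> : (m - e + (e - b.+1) = m - b.+1)%N by have := ltn_ord b; lia.
have bm : (b.+1 <= m)%N by apply: leq_trans em.
rewrite -{1 3}(subnK bm) exprD; field.
by rewrite !gt_eqF.
Qed.

(** The iterates of [rank_step] on the transverse weight have the closed form
    [W] below, whose value at rank [0] is the Gaussian binomial. Expanding the
    left-hand side by rank would give the q-Vandermonde identity instead. *)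
Lemma rank_sum_transverse_weight N u :
  rank_sum F u N transverse_weight = gauss N u.
Proof.
pose D u j := \prod_(b < u) (q ^+ (j + b).+1 - 1).
have D0 v j : D v j != 0 by rewrite gt_eqF // prodr_gt0.
have DS v j : D v.+1 j = D v j * (q ^+ (j + v).+1 - 1).
  by rewrite /D big_ord_recr.
have DSl v j : D v.+1 j = (q ^+ j.+1 - 1) * D v j.+1.
  rewrite /D big_ord_recl addn0; congr (_ * _); apply: eq_bigr => b _.
  by rewrite lift0 addnS.
pose W v j := transverse_weight j * q ^+ (v * j) * D v N / D v j.
have stepW v j : rank_step F N (W v) j = W v.+1 j.
  have nz1 : q ^+ j.+1 - 1 != 0 by rewrite gt_eqF.
  have nz2 : q ^+ (j + v).+1 - 1 != 0 by rewrite gt_eqF.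
  have DSE : D v j.+1 = D v j * (q ^+ (j + v).+1 - 1) / (q ^+ j.+1 - 1).
    by rewrite -DS DSl mulrC mulKf.
  rewrite /rank_step /W DSE !DS /transverse_weight big_ord_recr /= -/q.
  rewrite -/(transverse_weight j).
  move: nz1 nz2 (D0 v j); rewrite mulnS mulSn !exprS !exprD.
  set a := q ^+ j; set b := q ^+ v; set c := q ^+ N; set d := q ^+ (v * j).
  by move=> nz1 nz2 nz3; field; rewrite nz1 nz2 nz3.
suff gen v w : rank_sum F v N (W w) = W (w + v)%N 0%N.
  transitivity (rank_sum F u N (W 0%N)).
    by apply: eq_rank_sum => j _; rewrite /W /D !big_ord0 divr1 !mulr1.
  rewrite gen add0n /W /transverse_weight big_ord0 muln0 !mul1r /D /gauss.
  by rewrite -prodfV -big_split.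
elim: v w => [|v IHv] w; first by rewrite rank_sum0 addn0.
rewrite rank_sumS -addSnnS -IHv; apply: eq_rank_sum => j _; exact: stepW.
Qed.

End TransverseWeight.

(** The Frankl-Wilson theorem for vector spaces, the intersection condition
    being expressed by the dimension of the sum. The family is restricted to
    each cell of subspaces transverse to a frame [C], where it becomes a set of
    matrices; the multiplicity with which a pair occurs in all the cells cancels
    the weight used in the kernel. *)
Theorem card_intersecting_subspaces p m N u (I : finType) (E : {set I})
    (x : I -> 'M['F_p]_(m, m + N)) : prime p -> (m <= N)%N -> (u <= m)%N ->
    {in E, forall i, row_free (x i)} ->
    {in E &, forall i j, i != j -> (m < \rank (x i + x j)%MS <= m + u)%N} ->
  #|E|%:R <= gauss 'F_p N u.
Proof.
move=> p_pr mN um free meet.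
have [psi [psiD psiN psi0 psi_nt]] := Fp_character p_pr.
pose w := transverse_weight 'F_p.
have w0 j : 0 <= w j by apply/ltW/transverse_weight_gt0.
have [g g_pd gE] := exists_posdef_kernel psiD psiN psi0 psi_nt
  (leq_subr u m) mN w0.
rewrite subKn // rank_sum_transverse_weight in gE.
set al := gauss _ _ _ in gE *.
have al0 : 0 <= al by rewrite /al -rank_sum_transverse_weight rank_sum_ge0.
pose e i j := (\rank (x i + x j)%MS - m)%N.
have eE i j : i \in E -> j \in E -> \rank (x i + x j)%MS = (m + e i j)%N.
  move=> iE jE; rewrite subnKC //.
  by rewrite -{1}(eqP (free i iE)) mxrankS ?addsmxSl.
have e_le i j : i \in E -> j \in E -> (e i j <= u)%N.
  move=> iE jE; rewrite /e leq_subLR; have [<-|ne] := eqVneq i j.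
    by rewrite (addsmx_idPr (submx_refl (x i))) (eqP (free i iE)) leq_addr.
  by case/andP: (meet i j iE jE ne).
have e_eq0 i j : i \in E -> j \in E -> (e i j == 0)%N = (i == j).
  move=> iE jE; rewrite /e subn_eq0; have [<-|ne] := eqVneq i j.
    by rewrite (addsmx_idPr (submx_refl (x i))) (eqP (free i iE)) leqnn.
  by case/andP: (meet i j iE jE ne) => lt _; rewrite leqNgt lt.
(* The cell of [C] consists of the subspaces on which [C] induces an
   isomorphism. *)
pose good i C := x i *m C \in unitmx.
have cell C : 0 <= \sum_(i in E) \sum_(j in E)
    (good i C && good j C)%:R * ((i == j)%:R * al - w (e i j)).
  pose EC := [set i in E | good i C].
  have -> : \sum_(i in E) \sum_(j in E)
      (good i C && good j C)%:R * ((i == j)%:R * al - w (e i j)) =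
      \sum_(i in EC) \sum_(j in EC) ((i == j)%:R * al - w (e i j)).
    rewrite [RHS]big_mkcond [LHS]big_mkcond; apply: eq_bigr => i _.
    rewrite inE; case: (i \in E) => //=; case: (good i C) => /=; last first.
      by rewrite big1 // => j _; rewrite mul0r.
    rewrite [RHS]big_mkcond [LHS]big_mkcond; apply: eq_bigr => j _.
    rewrite inE; case: (j \in E) => //=.
    by case: (good j C); rewrite ?mul1r ?mul0r.
  have [->|[i0]] := set_0Vmem EC; first by rewrite big_set0.
  rewrite inE => /andP[i0E good0].
  have freeCT : row_free C^T.
    apply/row_freeP; exists ((invmx (x i0 *m C) *m x i0)^T).
    by rewrite -trmx_mul -mulmxA mulVmx // trmx1.
  have [G uG CG] := row_free_completion freeCT.
  (* [K] completes [C] to an invertible matrix; in these coordinates the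
     normalised frame of [x i] becomes [(1 | X i)]. *)
  pose K := (dsubmx (invmx G))^T.
  have uCK : row_mx C K \in unitmx.
    rewrite -unitmx_tr tr_row_mx trmxK.
    have -> : C^T = usubmx (invmx G).
      rewrite -[C^T](mulmxK uG) CG -{1}[invmx G]vsubmxK mul_row_col.
      by rewrite mul1mx mul0mx addr0.
    by rewrite vsubmxK unitmx_inv.
  pose X i := invmx (x i *m C) *m x i *m K.
  have rX i j : i \in EC -> j \in EC -> \rank (X i - X j) = e i j.
    rewrite !inE => /andP[iE gi] /andP[jE gj].
    apply/eqP; rewrite -(eqn_add2l m) -eE //.
    rewrite -mxrank_opp opprB -[X i]mul1mx -rank_block1 block_mxEv.
    have hat k : good k C ->
        row_mx 1%:M (X k) = invmx (x k *m C) *m x k *m row_mx C K.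
      by move=> gk; rewrite mul_mx_row -(mulmxA _ (x k) C) mulVmx.
    rewrite !hat // -mul_col_mx mxrankMfree ?row_free_unit // -addsmxE.
    have full k : good k C -> row_full (invmx (x k *m C)).
      by move=> gk; rewrite row_full_unit unitmx_inv.
    by rewrite (adds_eqmx (eqmxMfull _ (full _ gi)) (eqmxMfull _ (full _ gj))).
  have := g_pd _ EC X; congr (0 <= _); apply: eq_bigr => i iEC.
  apply: eq_bigr => j jEC; have := iEC; have := jEC; rewrite !inE.
  move=> /andP[jE _] /andP[iE _].
  by rewrite gE rX // ?e_le // -mxrank_eq0 rX // e_eq0.
apply: natr_le_of_sum_ge0 => //.
pose c : algC := (\prod_(l < m) (#|'F_p|%:R ^+ m - #|'F_p|%:R ^+ l)) *
  #|'F_p|%:R ^+ (N * m).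
have c0 : 0 < c by rewrite mulr_gt0 ?row_free_count_gt0 // exprn_gt0 // q_gt0.
rewrite -(pmulr_rge0 _ c0) mulr_sumr.
have := sumr_ge0 (index_enum _) (fun C (_ : xpredT C) => cell C).
congr (0 <= _).
rewrite exchange_big; apply: eq_bigr => i iE; rewrite exchange_big mulr_sumr.
apply: eq_bigr => j jE; rewrite -mulr_suml.
have eN : (e i j <= N)%N.
  by rewrite -(leq_add2l m) -eE // rank_leq_col.
have em : (e i j <= m)%N := leq_trans (e_le i j iE jE) um.
rewrite (count_transverse (free i iE) (free j jE) (eE i j iE jE)).
rewrite transverse_weightE // -/w /c -!mulrA; congr (_ * (_ * _)).
have := e_eq0 i j iE jE; case: (i == j) => [/eqP ->|_].
  by rewrite /w /transverse_weight big_ord0 invr1 !mul1r.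
by rewrite mul0r !sub0r mulrN mulVf // gt_eqF // transverse_weight_gt0.
Qed.
(** * Residue rings, unimodular matrices and row spans *)

(** A set [E] of representatives of the fibres gives [#|phi @: A| <= a]. *)
Lemma card_le_transversal_fiber (R : numDomainType) (T U : finType)
    (A : {set T}) (phi : T -> U) (a b : R) : 0 <= b ->
    (forall E : {set T}, E \subset A -> {in E &, injective phi} ->
       #|E|%:R <= a) ->
    (forall E : {set T}, E \subset A -> {in E &, forall x y, phi x = phi y} ->
       #|E|%:R <= b) ->
  #|A|%:R <= a * b.
Proof.
move=> b0 trans fib.
pose rep y := [pick x in A | phi x == y].
pose E := [set x in A | rep (phi x) == Some x].
have EA : E \subset A by apply/subsetP => x; rewrite inE => /andP[].
have injE : {in E &, injective phi}.
  move=> x y; rewrite !inE => /andP[_ /eqP px] /andP[_ /eqP py] e.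
  by move: px; rewrite e py => -[].
have imE : phi @: A \subset phi @: E.
  apply/subsetP => y /imsetP[x xA ->].
  have [z repz] : exists z, rep (phi x) = Some z.
    rewrite /rep; case: pickP => [z _|/(_ x)]; first by exists z.
    by rewrite /= xA eqxx.
  have /andP[zA /eqP zx] : (z \in A) && (phi z == phi x).
    by move: repz; rewrite /rep; case: pickP => [t ? [<-]|].
  by apply/imsetP; exists z => //; rewrite inE zA zx repz eqxx.
rewrite -sum1_card natr_sum (partition_big_imset phi) /=.
apply: (@le_trans _ _ (\sum_(y in phi @: A) b)).
  apply: ler_sum => y _; rewrite -natr_sum sum1_card.
  have -> : #|[pred x in A | phi x == y]| = #|[set x in A | phi x == y]|.
    by apply: eq_card => x; rewrite !inE.
  apply: fib => [|x x']; first by apply/subsetP => x; rewrite inE => /andP[].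
  by rewrite !inE => /andP[_ /eqP ->] /andP[_ /eqP ->].
rewrite sumr_const -[leLHS]mulr_natl ler_wpM2r //.
apply: le_trans (trans _ EA injE); rewrite ler_nat.
by rewrite -(card_in_imset injE) subset_leq_card.
Qed.

Section Reduction.
Variables (h k : nat).
Hypotheses (h_gt1 : (1 < h)%N) (k_gt1 : (1 < k)%N) (k_h : (k %| h)%N).

Lemma natr_Zp_mod n : ((n %% h)%:R : 'Z_k) = n%:R.
Proof. by apply: ord_inj; rewrite !val_Zp_nat // modn_dvdm. Qed.

(** [Zred] with the hypotheses that make it a ring morphism as arguments, so
    that the morphism structure can be inferred. *)
Definition zred of (1 < h)%N & (1 < k)%N & (k %| h)%N : 'Z_h -> 'Z_k :=
  @Zred h k.

Lemma modn_Zp_trunc c : (c %% (Zp_trunc h).+2 = c %% h)%N.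
Proof. by rewrite Zp_cast. Qed.

Lemma val_ZpD (x y : 'Z_h) : (x + y : 'Z_h) = ((x + y)%N %% h)%N :> nat.
Proof. by rewrite -modn_Zp_trunc. Qed.

Lemma val_ZpM (x y : 'Z_h) : (x * y : 'Z_h) = ((x * y)%N %% h)%N :> nat.
Proof. by rewrite -modn_Zp_trunc. Qed.

Lemma zred_is_nmod_morphism : nmod_morphism (zred h_gt1 k_gt1 k_h).
Proof.
split=> // x y; rewrite /zred /Zred val_ZpD natr_Zp_mod natrD //.
Qed.

Lemma zred_is_monoid_morphism : monoid_morphism (zred h_gt1 k_gt1 k_h).
Proof.
split=> [|x y]; last by rewrite /zred /Zred val_ZpM natr_Zp_mod natrM.
by rewrite /zred /Zred -[1%R : 'Z_h]/(1%:R) val_Zp_nat // modn_small.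
Qed.

HB.instance Definition _ := GRing.isNmodMorphism.Build 'Z_h 'Z_k
  (zred h_gt1 k_gt1 k_h) zred_is_nmod_morphism.
HB.instance Definition _ := GRing.isMonoidMorphism.Build 'Z_h 'Z_k
  (zred h_gt1 k_gt1 k_h) zred_is_monoid_morphism.

Let red := zred h_gt1 k_gt1 k_h.

Definition zlift (y : 'Z_k) : 'Z_h := (nat_of_ord y)%:R.

Lemma zredK y : red (zlift y) = y.
Proof. by rewrite /red rmorph_nat natr_Zp. Qed.

Lemma map_zredK a b (M : 'M['Z_k]_(a, b)) : map_mx red (map_mx zlift M) = M.
Proof. by apply/matrixP => i j; rewrite !mxE zredK. Qed.

End Reduction.

Section Unimodular.
Variables k n : nat.

Lemma unimodularP l (M : 'M['Z_k]_(l, n)) :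
  reflect (exists N, M *m N = 1%:M) (unimodular M).
Proof. exact: 'exists_eqP. Qed.

Definition rowspan l (M : 'M['Z_k]_(l, n)) : {set 'rV['Z_k]_n} :=
  [set u *m M | u : 'rV_l].

Lemma rowspanP l (M : 'M['Z_k]_(l, n)) v :
  reflect (exists u, v = u *m M) (v \in rowspan M).
Proof.
by apply: (iffP imsetP) => [[u _ ->]|[u ->]]; [exists u | exists u].
Qed.

Lemma row_rowspanP a l (M : 'M['Z_k]_(l, n)) (D : 'M_(a, n)) :
  (exists U, D = U *m M) <-> (forall i, row i D \in rowspan M).
Proof.
split=> [[U ->] i|H].
  by apply/rowspanP; exists (row i U); rewrite row_mul.
have /fin_all_exists[U UE] i : exists u, row i D = u *m M.
  exact/rowspanP.
exists (\matrix_i U i); apply/row_matrixP => i.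
by rewrite row_mul rowK UE.
Qed.

Lemma msubspacesP m A : reflect
  (exists2 M : 'M['Z_k]_(m, n), unimodular M & A = rowspan M)
  (A \in msubspaces k n m).
Proof.
rewrite inE.
apply: (iffP existsP) => [[M /andP[uM /andP[_ /eqP ->]]]|[M uM ->]].
  by exists M.
exists M; rewrite uM /= /is_basis eqxx andbT; apply/injectiveP => u v.
case/unimodularP: uM => N MN1 /(congr1 (mulmx^~ N)).
by rewrite -!mulmxA MN1 !mulmx1.
Qed.

Lemma unimodular_rowsub a l (f : 'I_a -> 'I_l) (M : 'M['Z_k]_(l, n)) :
  injective f -> unimodular M -> unimodular (rowsub f M).
Proof.
move=> injf /unimodularP[N MN1]; apply/unimodularP; exists (colsub f N).
apply/matrixP => i j; have /matrixP/(_ (f i) (f j)) := MN1.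
rewrite !mxE (inj_eq injf) => <-; apply: eq_bigr => c _; by rewrite !mxE.
Qed.

Lemma zdim_geP d (V : {set 'rV['Z_k]_n}) :
  (exists2 D : 'M['Z_k]_(d, n), unimodular D & forall i, row i D \in V)
  <-> (d <= zdim V)%N.
Proof.
split=> [[D uD DV]|]; first exact: zdim_max uD DV.
pose Q := [pred l : 'I_n.+1 | [exists M : 'M['Z_k]_(l, n),
  unimodular M && [forall i, row i M \in V]]].
have Q0 : (0 < #|Q|)%N.
  apply/card_gt0P; exists ord0; apply/existsP; exists 0.
  apply/andP; split; last by apply/forallP => -[].
  by apply/unimodularP; exists 0; apply/matrixP => -[].
have [l /existsP[M /andP[uM /forallP MV]] lE] :=
  eq_bigmax_cond (fun l : 'I_n.+1 => l : nat) Q0.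
rewrite /zdim lE => dl.
exists (rowsub (widen_ord dl) M).
  by apply: unimodular_rowsub uM => i j /(congr1 val) /= ?; apply: val_inj.
by move=> i; rewrite row_rowsub.
Qed.

Lemma zdim_rowspanP d l (M M' : 'M['Z_k]_(l, n)) :
  (exists U V : 'M['Z_k]_(d, l), unimodular (U *m M) /\ U *m M = V *m M')
  <-> (d <= zdim (rowspan M :&: rowspan M'))%N.
Proof.
rewrite -zdim_geP; split=> [[U [V [uD e]]]|[D uD DV]].
  exists (U *m M) => // i; rewrite inE; apply/andP; split; apply/rowspanP.
    by exists (row i U); rewrite row_mul.
  by exists (row i V); rewrite e row_mul.
have [|U DU] := (row_rowspanP M D).2.
  by move=> i; have := DV i; rewrite inE => /andP[].
have [|V DV'] := (row_rowspanP M' D).2.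
  by move=> i; have := DV i; rewrite inE => /andP[].
by exists U, V; rewrite -DU -DV'.
Qed.

End Unimodular.
(** The condition covers equal vertices too, since a [(d + u)]-subspace contains
    a free summand of rank [d]. *)
Lemma is_cliqueP k n d u (C : {set {set 'rV['Z_k]_n}}) :
  is_clique (msubspaces k n (d + u)) (grassmann_adj k n u.+1 (d + u)) C <->
  {subset C <= msubspaces k n (d + u)} /\
  {in C &, forall A B, (d <= zdim (A :&: B))%N}.
Proof.
have adjE A B : grassmann_adj k n u.+1 (d + u) A B =
    (A != B) && (d <= zdim (A :&: B))%N.
  by rewrite /grassmann_adj addnS ltnS leq_add2r.
rewrite /is_clique; split=> [/andP[/subsetP sub /forall_inP adj]|[sub meet]].
  split=> // A B AC BC; have [<-|ne] := eqVneq A B.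
    rewrite setIid; have /msubspacesP[M uM ->] := sub A AC.
    rewrite -[rowspan M]setIid; apply/zdim_rowspanP.
    exists (usubmx 1%:M), (usubmx 1%:M); split=> //.
    have -> : usubmx 1%:M *m M = rowsub (lshift u) M.
      by rewrite mul_usub_mx mul1mx usubmxEsub.
    exact: unimodular_rowsub (@lshift_inj _ _) uM.
  have /forall_inP/(_ B BC) := adj A AC.
  by rewrite ne adjE ne.
apply/andP; split; first exact/subsetP.
apply/forall_inP => A AC; apply/forall_inP => B BC.
by apply/implyP => ne; rewrite adjE ne meet.
Qed.

(** * Cliques over a prime power modulus *)

Section PrimePower.
Variables (p s : nat) (p_pr : prime p) (s_gt0 : (0 < s)%N).

Let k_gt1 : (1 < p ^ s)%N.
Proof. by rewrite -(exp1n s) ltn_exp2r // prime_gt1. Qed.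

Let pdiv_gt1 : (1 < pdiv p)%N.
Proof. by rewrite pdiv_id // prime_gt1. Qed.

Let pdiv_dvd : (pdiv p %| p ^ s)%N.
Proof. by rewrite pdiv_id // dvdn_exp. Qed.

Let red : 'Z_(p ^ s) -> 'F_p := zred k_gt1 pdiv_gt1 pdiv_dvd.
Let mred a b (M : 'M['Z_(p ^ s)]_(a, b)) : 'M['F_p]_(a, b) := map_mx red M.
Let mlift a b (M : 'M['F_p]_(a, b)) : 'M['Z_(p ^ s)]_(a, b) :=
  map_mx (@zlift (p ^ s) (pdiv p)) M.

Let mliftK a b (M : 'M['F_p]_(a, b)) : mred (mlift M) = M.
Proof. exact: map_zredK. Qed.

Lemma natr_Fp_eq0 n : (n%:R == 0 :> 'F_p) = (p %| n)%N.
Proof. by rewrite -(dvdn_pcharf (pchar_Fp p_pr)). Qed.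

Lemma unit_zred x : (x \is a GRing.unit) = (red x != 0).
Proof.
rewrite -{1}[x]natr_Zp unitZpE // coprime_pexpl // prime_coprime //.
by rewrite -natr_Fp_eq0.
Qed.

Lemma unitmx_zred a (M : 'M_a) : (M \in unitmx) = (mred M \in unitmx).
Proof. by rewrite !unitmxE unit_zred unitfE /mred /red det_map_mx. Qed.

(** Over a local ring a matrix has a right inverse as soon as its reduction
    has one: the lift of a right inverse is one up to a unit. *)
Lemma unimodular_zred l n (M : 'M_(l, n)) : unimodular M = row_free (mred M).
Proof.
apply/unimodularP/row_freeP => [[N MN1]|[B MB1]].
  by exists (mred N); rewrite -map_mxM MN1 map_mx1.
have uMB : M *m mlift B \in unitmx.
  by rewrite unitmx_zred /mred map_mxM -/(mred _) -/(mred _) mliftK MB1 unitmx1.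
by exists (mlift B *m invmx (M *m mlift B)); rewrite mulmxA mulmxV.
Qed.

(** The fibres of reduction are translates of each other. *)
Lemma card_zred_preim a b (P : pred 'M['F_p]_(a, b)) :
  #|[set M | P (mred M)]| = (p ^ ((s - 1) * (a * b)) * #|[set X | P X]|)%N.
Proof.
pose f := #|[set M : 'M_(a, b) | mred M == 0]|.
have fibE (X : 'M_(a, b)) : #|[set M | mred M == X]| = f.
  transitivity #|[set mlift X + M | M in [set M : 'M_(a, b) | mred M == 0]]|.
    2: by apply: card_imset; apply: addrI.
  apply: eq_card => M; rewrite inE; apply/eqP/imsetP => [eM|[M1]].
    exists (M - mlift X); last by rewrite addrC subrK.
    by rewrite inE /mred raddfB /= -!/(mred _) eM mliftK subrr.
  rewrite inE => /eqP M0 ->.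
  by rewrite /mred raddfD /= -!/(mred _) mliftK M0 addr0.
have cardE (Q : pred 'M['F_p]_(a, b)) :
    #|[set M | Q (mred M)]| = (#|[set X | Q X]| * f)%N.
  rewrite -sum1_card.
  rewrite (partition_big (@mred a b) (mem [set X | Q X])) /=; last first.
    by move=> M; rewrite !inE.
  rewrite -sum_nat_const; apply: eq_bigr => X; rewrite inE => QX.
  rewrite sum1_card -(fibE X); apply: eq_card => M; rewrite !inE.
  rewrite unfold_in /= inE; case: eqP => [->|_]; last by rewrite andbF.
  by rewrite QX.
have k0 : (0 < p)%N := prime_gt0 p_pr.
have fE : f = (p ^ ((s - 1) * (a * b)))%N.
  apply/eqP; rewrite -(@eqn_pmul2l (p ^ (a * b))) ?expn_gt0 ?k0 //.
  rewrite -expnD -mulSn.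
  have := cardE predT; rewrite !cardsT !card_mx card_Fp // card_ord Zp_cast //.
  by rewrite -expnM => <-; rewrite subn1 prednK.
by rewrite cardE fE mulnC.
Qed.

Lemma card_unimodular l n :
  #|[set M : 'M['Z_(p ^ s)]_(l, n) | unimodular M]|%:R =
  p%:R ^+ ((s - 1) * (l * n)) * \prod_(j < l) (p%:R ^+ n - p%:R ^+ j) :> algC.
Proof.
transitivity (#|[set M : 'M['Z_(p ^ s)]_(l, n) | row_free (mred M)]|%:R : algC).
  by congr _%:R; apply: eq_card => M; rewrite !inE unimodular_zred.
rewrite (card_zred_preim (fun X : 'M['F_p]_(l, n) => row_free X)) natrM natrX.
congr (_ * _).
by have := card_row_free 'F_p algC l n; rewrite card_Fp.
Qed.

(** The subspaces that contain the span of the first [d] basis vectors. *)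
Definition star_clique d u n : {set {set 'rV['Z_(p ^ s)]_(d + n)}} :=
  [set rowspan (block_mx 1%:M 0 0 B : 'M_(d + u, d + n))
     | B : 'M['Z_(p ^ s)]_(u, n) & unimodular B].

Lemma star_is_clique d u n :
  is_clique (msubspaces (p ^ s) (d + n) (d + u))
    (grassmann_adj (p ^ s) (d + n) u.+1 (d + u)) (star_clique d u n).
Proof.
apply/is_cliqueP; split=> [A|A A'] /imsetP[B]; rewrite inE => uB ->.
  apply/msubspacesP; exists (block_mx 1%:M 0 0 B) => //.
  have /unimodularP[B' BB'] := uB; apply/unimodularP.
  exists (block_mx 1%:M 0 0 B'); rewrite mulmx_block.
  by rewrite !mulmx0 !mul0mx !addr0 !add0r mulmx1 BB' -scalar_mx_block.
case/imsetP => B' _ ->; apply/zdim_rowspanP.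
exists (row_mx 1%:M 0), (row_mx 1%:M 0).
rewrite !mul_row_block !mul0mx !mul1mx !addr0; split=> //.
apply/unimodularP; exists (col_mx 1%:M 0).
by rewrite mul_row_col mulmx0 addr0 mulmx1.
Qed.

(** Frames of the same subspace differ by an invertible matrix. *)
Lemma card_star_clique d u n :
  (#|[set B : 'M['Z_(p ^ s)]_(u, n) | unimodular B]|
   <= #|star_clique d u n| * #|[set P : 'M['Z_(p ^ s)]_u | unimodular P]|)%N.
Proof.
pose span (B : 'M['Z_(p ^ s)]_(u, n)) :=
  rowspan (block_mx 1%:M 0 0 B : 'M_(d + u, d + n)).
rewrite -sum1_card (partition_big_imset span) /= -/(star_clique d u n).
rewrite -sum_nat_const; apply: leq_sum => A _.
have [B0 /andP[uB0 /eqP B0A]|none] :=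
  pickP [pred B | (B \in [set B | unimodular B]) && (span B == A)]; last first.
  by rewrite big_pred0.
rewrite sum1_card (leq_trans _ (leq_imset_card (mulmx^~ B0) _)) //.
apply/subset_leq_card/subsetP => B /andP[uB /eqP BA].
rewrite inE in uB; have /unimodularP[N BN1] := uB.
have [|U UE] := (row_rowspanP (block_mx 1%:M 0 0 B0 : 'M_(d + u, d + n))
    (block_mx 1%:M 0 0 B : 'M_(d + u, d + n))).2.
  move=> i; rewrite -/(span B0) B0A -BA.
  by apply/rowspanP; exists (row i 1%:M); rewrite -row_mul mul1mx.
have BE : B = drsubmx U *m B0.
  have := congr1 drsubmx UE; rewrite block_mxKdr -{1}[U]submxK mulmx_block.
  by rewrite block_mxKdr mulmx0 add0r.
apply/imsetP; exists (drsubmx U) => //; rewrite inE.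
by apply/unimodularP; exists (B0 *m N); rewrite mulmxA -BE.
Qed.

Lemma gaussE N u : gauss 'F_p N u =
  \prod_(l < u) ((p%:R ^+ (u + N) - p%:R ^+ l) / (p%:R ^+ u - p%:R ^+ l)).
Proof.
rewrite /gauss card_Fp // [RHS](reindex_inj rev_ord_inj).
apply: eq_bigr => b _ /=.
have p_gt0 : 0 < p%:R :> algC by rewrite ltr0n prime_gt0.
have bu : (b.+1 <= u)%N := ltn_ord b.
have -> : (u + N = (u - b.+1) + (N + b).+1)%N by lia.
have -> : p%:R ^+ u = p%:R ^+ (u - b.+1) * p%:R ^+ b.+1 :> algC.
  by rewrite -exprD subnK.
have nz : p%:R ^+ b.+1 - 1 != 0 :> algC.
  by rewrite subr_eq0 gt_eqF // exprn_egt1 // ltr1n prime_gt1.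
have fac (a x : algC) : a * x - a = a * (x - 1) by rewrite mulrBr mulr1.
rewrite exprD !fac.
by rewrite -mulf_div divff ?mul1r // gt_eqF // exprn_gt0.
Qed.

Lemma star_clique_ge d u N :
  p%:R ^+ ((s - 1) * (u * N)) * gauss 'F_p N u
  <= #|star_clique d u (u + N)|%:R :> algC.
Proof.
have p_gt0 : 0 < p%:R :> algC by rewrite ltr0n prime_gt0.
have GLu_gt0 : 0 < \prod_(j < u) (p%:R ^+ u - p%:R ^+ j) :> algC.
  by have := @row_free_count_gt0 'F_p algC u u (leqnn u); rewrite card_Fp.
have := card_star_clique d u (u + N).
rewrite -(ler_nat algC) natrM !card_unimodular mulnDr mulnDr exprD.
rewrite [X in _ <= X]mulrCA -[X in X <= _]mulrA ler_pM2l ?exprn_gt0 //.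
rewrite gaussE prodf_div => le.
by rewrite mulrA ler_pdivrMr.
Qed.

Lemma zred_eq0_of_mul (j : nat) (y : 'Z_(p ^ s)) :
  (j < s)%N -> (p ^ j)%:R * y = 0 -> red y = 0.
Proof.
move=> js; rewrite -{1}[y]natr_Zp -natrM => /(congr1 (@nat_of_ord _)).
rewrite val_Zp_nat // => /eqP; rewrite -/(dvdn _ _) => dv.
apply/eqP; rewrite /red /zred /Zred natr_Fp_eq0.
rewrite -(@dvdn_pmul2l (p ^ j)) ?expn_gt0 ?prime_gt0 // -expnSr.
by rewrite (dvdn_trans _ dv) // dvdn_exp2l.
Qed.

Lemma modn_expS x j :
  (x %% p ^ j.+1 = (x %/ p ^ j) %% p * p ^ j + x %% p ^ j)%N.
Proof.
have p_gt0 := prime_gt0 p_pr.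
have lt : ((x %/ p ^ j) %% p * p ^ j + x %% p ^ j < p ^ j.+1)%N.
  rewrite (@leq_trans (((x %/ p ^ j) %% p).+1 * p ^ j)) //.
    by rewrite mulSn addnC ltn_add2r ltn_mod expn_gt0 p_gt0.
  by rewrite expnS leq_mul2r ltn_mod p_gt0 orbT.
rewrite -[RHS](modn_small lt) -[RHS](modnMDl (x %/ p ^ j %/ p)).
congr (_ %% _)%N; rewrite expnS mulnA addnA -mulnDl -divn_eq.
exact: divn_eq.
Qed.

Definition zdigit (j : nat) (y : 'Z_(p ^ s)) : 'F_p := (y %/ p ^ j)%:R.

(** When [X] and [X'] agree modulo [p ^ j], their difference is [p ^ j] times
    that of their shifted entries, and [p ^ j * y = 0] forces [p] to divide
    [y]. *)
Lemma mulmx_zdigit d m N j (S : 'M['Z_(p ^ s)]_(d, m))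
    (X X' : 'M['Z_(p ^ s)]_(m, N)) :
    (j < s)%N -> (forall a b, X a b = X' a b %[mod p ^ j]) ->
    S *m X = S *m X' ->
  mred S *m (map_mx (zdigit j) X - map_mx (zdigit j) X') = 0.
Proof.
move=> js mod_eq SX; apply/matrixP => a b; rewrite !mxE.
pose y := \sum_c S a c * ((X c b %/ p ^ j)%:R - (X' c b %/ p ^ j)%:R).
transitivity (red y).
  rewrite /y /red rmorph_sum; apply: eq_bigr => c _.
  by rewrite !mxE rmorphM rmorphB !rmorph_nat.
apply: (zred_eq0_of_mul js); rewrite /y mulr_sumr.
have /matrixP/(_ a b) := SX; rewrite !mxE => /eqP.
rewrite -subr_eq0 -sumrB => /eqP e.
rewrite -[RHS]e; apply: eq_bigr => c _.
rewrite mulrCA -mulrBr; congr (_ * _).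
rewrite -[in RHS](natr_Zp (X c b)) -[in RHS](natr_Zp (X' c b)).
rewrite [in RHS](divn_eq (X c b) (p ^ j)) [in RHS](divn_eq (X' c b) (p ^ j)).
by rewrite mod_eq !natrD !natrM; ring.
Qed.

(** Induction on the number of digits left. The [j]-th digits form a set of
    matrices over the residue field whose differences are killed by the
    reduction of a unimodular matrix with [d] rows, hence have rank at most
    [u]. *)
Lemma card_layered_anticode d u N (I : finType) (E : {set I})
    (X : I -> 'M['Z_(p ^ s)]_(d + u, N)) j :
    (d + u <= N)%N -> (j <= s)%N -> {in E &, injective X} ->
    {in E &, forall i i' a b, X i a b = X i' a b %[mod p ^ j]} ->
    {in E &, forall i i', exists2 S : 'M_(d, d + u),
       unimodular S & S *m X i = S *m X i'} ->
  #|E|%:R <= p%:R ^+ (u * N * (s - j)) :> algC.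
Proof.
move=> mN; have [l] : exists l, l = (s - j)%N by exists (s - j)%N.
elim: l j E => [|l IHl] j E lE js injX modX meetX.
  rewrite -lE muln0 expr0 lern1; apply/card_le1_eqP => i i' iE i'E.
  apply: injX => //; apply/matrixP => a b; apply: ord_inj.
  have := modX i i' iE i'E a b; have -> : j = s by lia.
  by rewrite !modn_small // -[X in (_ < X)%N](Zp_cast k_gt1).
have js' : (j < s)%N by lia.
have -> : (s - j = (s - j.+1).+1)%N by lia.
rewrite mulnS exprD.
apply: (@card_le_transversal_fiber _ _ _ _ (fun i => map_mx (zdigit j) (X i))).
- by rewrite exprn_ge0.
- move=> E' /subsetP sub injE'; rewrite -natrX ler_nat.
  apply: (card_rank_metric_anticode p_pr mN _ injE'); first exact: leq_addl.
  move=> i i' /sub iE /sub i'E; have [S uS SX] := meetX i i' iE i'E.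
  have := mulmx0_rank_max (mulmx_zdigit js' (modX i i' iE i'E) SX).
  by move: uS; rewrite unimodular_zred => /eqP ->; rewrite leq_add2l.
move=> E' /subsetP sub eqE'; apply: IHl => //; first lia.
- by move=> i i' /sub iE /sub i'E; apply: injX.
- move=> i i' iE' i'E' a b.
  have /matrixP/(_ a b) := eqE' i i' iE' i'E'; rewrite !mxE.
  move=> /(congr1 (@nat_of_ord _)); rewrite !val_Fp_nat // => e.
  by rewrite !modn_expS e (modX i i' (sub i iE') (sub i' i'E') a b).
by move=> i i' /sub iE /sub i'E; apply: meetX.
Qed.
Lemma rowspan_unitl n l (P : 'M_l) (M : 'M['Z_(p ^ s)]_(l, n)) : P \in unitmx ->
  rowspan (P *m M) = rowspan M.
Proof.
move=> uP; apply/setP => v; apply/rowspanP/rowspanP => [[u ->]|[u ->]].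
  by exists (u *m P); rewrite mulmxA.
by exists (u *m invmx P); rewrite mulmxA mulmxKV.
Qed.

Lemma mulmx_graph_eq (R : pzRingType) d m N (U V : 'M[R]_(d, m)) (P P' : 'M_m)
    (X X' : 'M_(m, N)) :
  U *m (P *m row_mx 1%:M X) = V *m (P' *m row_mx 1%:M X') ->
  U *m P *m X = U *m P *m X'.
Proof.
by rewrite !mulmxA !mul_mx_row !mulmx1 => /eq_row_mx[UPV ->]; rewrite UPV.
Qed.

(** Subspaces with the same reduction are graphs, in common coordinates, of
    matrices that vanish modulo [p]. *)
Lemma card_same_reduction d u N (I : finType) (E : {set I})
    (M : I -> 'M['Z_(p ^ s)]_(d + u, d + u + N)) :
    (d + u <= N)%N ->
    {in E, forall i, unimodular (M i)} ->
    {in E &, injective (fun i => rowspan (M i))} ->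
    {in E &, forall i i', (mred (M i) <= mred (M i'))%MS} ->
    {in E &, forall i i', exists U V : 'M_(d, d + u),
       unimodular (U *m M i) /\ U *m M i = V *m M i'} ->
  #|E|%:R <= p%:R ^+ (u * N * (s - 1)) :> algC.
Proof.
move=> mN uM injM redM meetM.
have [->|[i0 i0E]] := set_0Vmem E; first by rewrite cards0 exprn_ge0.
have free i : i \in E -> row_free (mred (M i)).
  by move=> iE; rewrite -unimodular_zred uM.
have [G0 uG0 G0E] := row_free_completion (free i0 i0E).
pose G := mlift G0; have uG : G \in unitmx by rewrite unitmx_zred mliftK.
pose P i := lsubmx (M i *m G); pose Q i := rsubmx (M i *m G).
have PQ i : M i *m G = row_mx (P i) (Q i) by rewrite hsubmxK.
have [uP redQ] : {in E, forall i, P i \in unitmx} /\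
    {in E, forall i, mred (Q i) = 0}.
  suff H i : i \in E -> P i \in unitmx /\ mred (Q i) = 0.
    by split=> i iE; case: (H i iE).
  move=> iE; have /submxP[T TE] := redM i i0 iE i0E.
  have : mred (M i *m G) = row_mx T 0.
    rewrite /mred map_mxM -!/(mred _) mliftK TE -mulmxA G0E.
    by rewrite mul_mx_row mulmx1 mulmx0.
  rewrite PQ /mred map_row_mx -!/(mred _) => /eq_row_mx[PT ->]; split=> //.
  rewrite unitmx_zred PT -row_free_unit.
  by have := free i iE; rewrite TE /row_free mxrankMfree // free.
pose X i := invmx (P i) *m Q i.
have XE i : i \in E -> P i *m row_mx 1%:M (X i) = M i *m G.
  by move=> iE; rewrite mul_mx_row mulmx1 /X mulKVmx ?uP // PQ.
have ME i : i \in E -> M i = P i *m (row_mx 1%:M (X i) *m invmx G).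
  by move=> iE; rewrite mulmxA XE // mulmxK.
pose graph (Y : 'M['Z_(p ^ s)]_(d + u, N)) :=
  rowspan (row_mx 1%:M Y *m invmx G).
have spanE i : i \in E -> graph (X i) = rowspan (M i).
  by move=> iE; rewrite (ME i iE); apply/esym/(rowspan_unitl _ (uP i iE)).
apply: (@card_layered_anticode d u N _ E X 1 mN s_gt0) =>
  [i i' iE i'E eX|i i' iE i'E a b|i i' iE i'E].
- apply: (injM i i' iE i'E).
  by rewrite -[LHS](spanE i iE) -[RHS](spanE i' i'E) /graph eX.
- have p_dvd k : k \in E -> (p ^ 1 %| X k a b)%N.
    move=> kE; rewrite expn1 -natr_Fp_eq0.
    have /matrixP/(_ a b) : mred (X k) = 0.
      by rewrite /mred /X map_mxM -!/(mred _) redQ // mulmx0.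
    by rewrite !mxE => /eqP.
  exact: etrans (eqP (p_dvd i iE)) (esym (eqP (p_dvd i' i'E))).
have [U [V [uU UV]]] := meetM i i' iE i'E.
have eG : U *m (P i *m row_mx 1%:M (X i)) = V *m (P i' *m row_mx 1%:M (X i')).
  by rewrite (XE i iE) (XE i' i'E) !mulmxA UV.
exists (U *m P i); last exact: (mulmx_graph_eq eG).
have /unimodularP[K UK] := uU; apply/unimodularP.
exists (row_mx 1%:M (X i) *m invmx G *m K).
by rewrite mulmxA -(mulmxA U) -(ME i iE).
Qed.

Lemma leq_of_add_eq a c d u :
  (a + c = d + u + (d + u) -> d <= c -> a <= d + u + u)%N.
Proof. lia. Qed.

(** A transversal of the reduction map is an intersecting family over the
    residue field; a fibre is bounded by card_same_reduction. *)
Theorem card_clique_le d u N (C : {set {set 'rV['Z_(p ^ s)]_(d + u + N)}}) :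
    (d + u <= N)%N ->
    is_clique (msubspaces (p ^ s) (d + u + N) (d + u))
      (grassmann_adj (p ^ s) (d + u + N) u.+1 (d + u)) C ->
  #|C|%:R <= p%:R ^+ ((s - 1) * (u * N)) * gauss 'F_p N u.
Proof.
move=> mN /is_cliqueP[sub meet].
pose frame (A : {set 'rV['Z_(p ^ s)]_(d + u + N)}) : 'M_(d + u, d + u + N) :=
  odflt 0 [pick M | unimodular M && (A == rowspan M)].
have frameP A : A \in C -> unimodular (frame A) /\ rowspan (frame A) = A.
  move=> /sub/msubspacesP[M uM AM]; rewrite /frame.
  case: pickP => [M' /andP[uM' /eqP AM'] //|/(_ M)].
  by rewrite uM AM eqxx.
have free A : A \in C -> row_free (mred (frame A)).
  by move=> /frameP[uA _]; rewrite -unimodular_zred.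
have meetM A B : A \in C -> B \in C -> exists U V : 'M_(d, d + u),
    unimodular (U *m frame A) /\ U *m frame A = V *m frame B.
  move=> AC BC; apply/zdim_rowspanP; have [_ ->] := frameP A AC.
  by have [_ ->] := frameP B BC; apply: meet.
rewrite mulrC.
apply: (@card_le_transversal_fiber _ _ _ C (fun A => <<mred (frame A)>>%MS)).
- by rewrite exprn_ge0.
- move=> E /subsetP EC injE.
  apply: (card_intersecting_subspaces (x := fun A => mred (frame A)) p_pr mN).
  + exact: leq_addl.
  + by move=> A /EC; apply: free.
  move=> A B AE BE ne; have AC := EC A AE; have BC := EC B BE.
  have rA := eqP (free A AC); have rB := eqP (free B BC).
  apply/andP; split.
    rewrite ltnNge; apply: contra ne => le; apply/eqP/injE => //.
    apply/genmxP/andP; split.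
      have := geq_leqif (mxrank_leqif_sup
        (addsmxSr (mred (frame A)) (mred (frame B)))).
      by rewrite rB le addsmx_sub => /esym/andP[].
    have := geq_leqif (mxrank_leqif_sup
      (addsmxSl (mred (frame A)) (mred (frame B)))).
    by rewrite rA le addsmx_sub => /esym/andP[].
  have [U [V [uU UV]]] := meetM A B AC BC.
  have : (d <= \rank (mred (frame A) :&: mred (frame B))%MS)%N.
    move: uU; rewrite unimodular_zred => /eqP rU; rewrite -{1}rU mxrankS //.
    rewrite sub_capmx {2}UV /mred !map_mxM -!/(mred _).
    by rewrite !submxMl.
  have := mxrank_sum_cap (mred (frame A)) (mred (frame B)).
  by rewrite rA rB; apply: leq_of_add_eq.
move=> E /subsetP EC eqE; rewrite mulnC.
apply: (@card_same_reduction d u N _ E frame mN).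
- by move=> A /EC/frameP[].
- move=> A B /EC AC /EC BC /=.
  by have [_ ->] := frameP A AC; have [_ ->] := frameP B BC.
- move=> A B AE BE; have /genmxP/andP[] // := eqE A B AE BE.
by move=> A B /EC AC /EC BC; apply: meetM.
Qed.

End PrimePower.
(** * Chinese remaindering of subspaces and cliques *)

Section ChineseRemainder.
Variables (t : nat) (K : 'I_t -> nat) (h : nat).
Hypotheses (K_gt1 : forall i, (1 < K i)%N) (h_gt1 : (1 < h)%N).
Hypothesis K_coprime : forall i j, i != j -> coprime (K i) (K j).
Hypothesis h_def : h = (\prod_(i < t) K i)%N.

Lemma modulus_dvd i : (K i %| h)%N.
Proof. by rewrite h_def (bigD1 i) //= dvdn_mulr. Qed.

Let red i : 'Z_h -> 'Z_(K i) := zred h_gt1 (K_gt1 i) (modulus_dvd i).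
Let mred i a b (M : 'M['Z_h]_(a, b)) : 'M['Z_(K i)]_(a, b) := map_mx (red i) M.

Lemma coprime_prod_seq i (r : seq 'I_t) (P : pred 'I_t) :
  {in r, forall j, P j -> i != j} -> coprime (K i) (\prod_(j <- r | P j) K j).
Proof.
move=> ne; rewrite big_seq_cond; elim/big_ind: _ => [|a b ca cb|j /andP[jr Pj]].
- exact: coprimen1.
- by rewrite coprimeMr ca.
- exact/K_coprime/ne.
Qed.

Lemma modulus_dvd_all a : (forall i, (K i %| a)%N) -> (h %| a)%N.
Proof.
move=> Ka; rewrite h_def; have := index_enum_uniq 'I_t.
elim: (index_enum _) => [|i r IHr] /=; first by rewrite big_nil dvd1n.
case/andP=> ir ur; rewrite big_cons Gauss_dvd ?Ka ?IHr //.
apply: coprime_prod_seq => j jr _; by apply: contraNneq ir => ->.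
Qed.

Lemma zred_inj (x y : 'Z_h) : (forall i, red i x = red i y) -> x = y.
Proof.
move=> e; apply: ord_inj; wlog le : x y e / (y <= x)%N.
  by move=> H; case: (leqP y x) => [|/ltnW] le; [exact: H | apply/esym/H].
have lt (z : 'Z_h) : (z < h)%N by rewrite -[X in (_ < X)%N](Zp_cast h_gt1).
rewrite -(modn_small (lt x)) -(modn_small (lt y)); apply/eqP.
rewrite eqn_mod_dvd //; apply: modulus_dvd_all => i; rewrite -eqn_mod_dvd //.
have /(congr1 (@nat_of_ord _)) := e i.
by rewrite /red /zred /Zred !val_Zp_nat // => ->.
Qed.

Lemma exists_zred (x : forall i, 'Z_(K i)) : exists y, forall i, red i y = x i.
Proof.
have /fin_all_exists[e eP] i : exists e : 'Z_h, forall j, red j e = (i == j)%:R.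
  (* The idempotent of the [i]-th factor. *)
  pose c := (\prod_(j < t | i != j) K j)%N.
  have co : coprime (K i) c by apply: coprime_prod_seq.
  exists (chinese (K i) c 1 0)%:R => j; rewrite /red rmorph_nat.
  apply: ord_inj; rewrite !val_Zp_nat //; have [<-|ne] := eqVneq i j.
    by rewrite chinese_modl.
  apply/eqP; rewrite -(modn_dvdm (m := c)) ?chinese_modr //.
    by rewrite !mod0n.
  by rewrite /c (bigD1 j) //= dvdn_mulr.
exists (\sum_i e i * (nat_of_ord (x i))%:R) => j.
rewrite /red rmorph_sum (bigD1 j) //= [X in _ + X]big1 => [|i /negPf ne].
  rewrite rmorphM rmorph_nat -[X in X * _]/(red j (e j)) eP eqxx.
  by rewrite mul1r natr_Zp addr0.
by rewrite rmorphM -[X in X * _]/(red j (e i)) eP ne mul0r.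
Qed.

Lemma mred_inj a b (M M' : 'M['Z_h]_(a, b)) :
  (forall i, mred i M = mred i M') -> M = M'.
Proof.
move=> e; apply/matrixP => x y; apply: zred_inj => i.
by have /matrixP/(_ x y) := e i; rewrite !mxE.
Qed.

Lemma exists_mred a b (X : forall i, 'M['Z_(K i)]_(a, b)) :
  exists M, forall i, mred i M = X i.
Proof.
have /fin_all_exists[f fP] (z : 'I_a * 'I_b) :
    exists y, forall i, red i y = X i z.1 z.2 by apply: exists_zred.
exists (\matrix_(x, y) f (x, y)) => i; apply/matrixP => x y.
by rewrite !mxE fP.
Qed.

Lemma mredM i a b c (M : 'M_(a, b)) (M' : 'M_(b, c)) :
  mred i (M *m M') = mred i M *m mred i M'.
Proof. exact: map_mxM. Qed.

Lemma mred1 i a : mred i (1%:M : 'M_a) = 1%:M.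
Proof. exact: map_mx1. Qed.

Lemma unimodular_mred l n (M : 'M_(l, n)) :
  unimodular M <-> forall i, unimodular (mred i M).
Proof.
split=> [/unimodularP[N MN1] i|uM].
  by apply/unimodularP; exists (mred i N); rewrite -mredM MN1 mred1.
have /fin_all_exists[N NP] i : exists N, mred i M *m N = 1%:M.
  exact/unimodularP.
have [N' N'E] := exists_mred N; apply/unimodularP; exists N'.
by apply: mred_inj => i; rewrite mredM N'E NP mred1.
Qed.

Section Subspaces.
Variable n : nat.
Implicit Types (A B : {set 'rV['Z_h]_n}).

Lemma mem_rowspan_mred l (M : 'M_(l, n)) v :
  v \in rowspan M <-> forall i, mred i v \in rowspan (mred i M).
Proof.
split=> [/rowspanP[u ->] i|vM].
  by apply/rowspanP; exists (mred i u); rewrite mredM.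
have /fin_all_exists[u uP] i : exists u, mred i v = u *m mred i M.
  exact/rowspanP/vM.
have [u' u'E] := exists_mred u; apply/rowspanP; exists u'.
by apply: mred_inj => i; rewrite mredM u'E uP.
Qed.

Lemma Vred_rowspan i l (M : 'M_(l, n)) :
  Vred (K i) (rowspan M) = rowspan (mred i M).
Proof.
apply/setP => v; apply/imsetP/rowspanP => [[w /rowspanP[u ->] ->]|[u ->]].
  by exists (mred i u); rewrite -mredM.
pose u' : 'rV['Z_h]_l := map_mx (@zlift h (K i)) u.
have u'E : mred i u' = u by apply: map_zredK.
exists (u' *m M); first by apply/rowspanP; exists u'.
by rewrite -[LHS]/(u *m mred i M) -{1}u'E -mredM.
Qed.

Lemma zdim_mred d l (M M' : 'M['Z_h]_(l, n)) :
  (d <= zdim (rowspan M :&: rowspan M'))%N <->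
  forall i, (d <= zdim (rowspan (mred i M) :&: rowspan (mred i M')))%N.
Proof.
split=> [/zdim_rowspanP[U [V [uU UV]]] i|H].
  apply/zdim_rowspanP; exists (mred i U), (mred i V).
  by rewrite -!mredM -UV; split=> //; move/unimodular_mred: uU; apply.
have /fin_all_exists[W WP] i : exists W : 'M_(d, l) * 'M_(d, l),
    unimodular (W.1 *m mred i M) /\ W.1 *m mred i M = W.2 *m mred i M'.
  by have /zdim_rowspanP[U [V UV]] := H i; exists (U, V).
have [U UE] := exists_mred (fun i => (W i).1).
have [V VE] := exists_mred (fun i => (W i).2).
apply/zdim_rowspanP; exists U, V; split.
  by apply/unimodular_mred => i; rewrite mredM UE; case: (WP i).
by apply: mred_inj => i; rewrite !mredM UE VE; case: (WP i).
Qed.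

Lemma msubspaces_Vred m A i :
  A \in msubspaces h n m -> Vred (K i) A \in msubspaces (K i) n m.
Proof.
case/msubspacesP => M uM ->; rewrite Vred_rowspan; apply/msubspacesP.
by exists (mred i M) => //; move/unimodular_mred: uM; apply.
Qed.

Lemma exists_Vred m (B : forall i, {set 'rV['Z_(K i)]_n}) :
  (forall i, B i \in msubspaces (K i) n m) ->
  exists2 A, A \in msubspaces h n m & forall i, Vred (K i) A = B i.
Proof.
move=> BV; have /fin_all_exists2[M uM ME] i :
  exists2 M : 'M_(m, n), unimodular M & B i = rowspan M by apply/msubspacesP.
have [M' M'E] := exists_mred M; exists (rowspan M').
  apply/msubspacesP; exists M' => //; apply/unimodular_mred => i.
  by rewrite M'E.
by move=> i; rewrite Vred_rowspan M'E ME.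
Qed.

Lemma Vred_inj m A B : A \in msubspaces h n m -> B \in msubspaces h n m ->
  (forall i, Vred (K i) A = Vred (K i) B) -> A = B.
Proof.
case/msubspacesP => M _ -> /msubspacesP[M' _ ->] e; apply/setP => v.
apply/idP/idP => /mem_rowspan_mred H; apply/mem_rowspan_mred => i.
  by rewrite -Vred_rowspan -e Vred_rowspan.
by rewrite -Vred_rowspan e Vred_rowspan.
Qed.

Lemma zdim_Vred m d A B : A \in msubspaces h n m -> B \in msubspaces h n m ->
  (d <= zdim (A :&: B))%N <->
  forall i, (d <= zdim (Vred (K i) A :&: Vred (K i) B))%N.
Proof.
case/msubspacesP => M _ -> /msubspacesP[M' _ ->]; rewrite zdim_mred.
by split=> H i; have := H i; rewrite !Vred_rowspan.
Qed.

Section CliqueProduct.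
Variables d u : nat.
Let clique k :=
  is_clique (msubspaces k n (d + u)) (grassmann_adj k n u.+1 (d + u)).

Lemma clique_Vred i (C : {set {set 'rV['Z_h]_n}}) :
  clique C -> clique [set Vred (K i) A | A in C].
Proof.
case/is_cliqueP => sub meet; apply/is_cliqueP.
split=> [_ /imsetP[A AC ->]|_ _ /imsetP[A AC ->] /imsetP[B BC ->]].
  exact/msubspaces_Vred/sub.
by have /zdim_Vred := meet A B AC BC; apply; apply: sub.
Qed.

Let fT (i : 'I_t) : finType := {set 'rV['Z_(K i)]_n}.
Let reductions A : {dffun forall i, fT i} := [ffun i => Vred (K i) A : fT i].

Lemma card_clique_le_prod (C : {set {set 'rV['Z_h]_n}}) : clique C ->
  (#|C| <= \prod_i #|[set Vred (K i) A | A in C]|)%N.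
Proof.
case/is_cliqueP => sub _.
have injr : {in C &, injective reductions}.
  move=> A B /sub AV /sub BV /ffunP e; apply: (Vred_inj AV BV) => i.
  by have := e i; rewrite !ffunE.
rewrite -(card_in_imset injr) -(@cardsXn _ fT); apply/subset_leq_card/subsetP.
move=> _ /imsetP[A AC ->]; rewrite in_setXn; apply/forallP => i.
by rewrite ffunE imset_f.
Qed.

Lemma clique_product (C : forall i, {set {set 'rV['Z_(K i)]_n}}) :
    (forall i, clique (C i)) ->
  exists2 D : {set {set 'rV['Z_h]_n}}, clique D & (\prod_i #|C i| <= #|D|)%N.
Proof.
move=> CC.
pose D := [set A in msubspaces h n (d + u) | [forall i, Vred (K i) A \in C i]].
exists D.
  apply/is_cliqueP; split=> [A|A B]; first by rewrite inE => /andP[].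
  rewrite [A \in D]inE [B \in D]inE.
  move=> /andP[AV /forallP AC] /andP[BV /forallP BC].
  apply: (zdim_Vred d AV BV).2 => i; have /is_cliqueP[_ meet] := CC i.
  exact: meet (AC i) (BC i).
rewrite -(@cardsXn _ fT) (leq_trans _ (leq_imset_card reductions D)) //.
apply/subset_leq_card/subsetP => B; rewrite in_setXn => /forallP BC.
have BV i : B i \in msubspaces (K i) n (d + u).
  by have /is_cliqueP[sub _] := CC i; apply/sub/BC.
have [A AV AB] := exists_Vred BV; apply/imsetP; exists A.
  by rewrite inE AV; apply/forallP => i; rewrite AB; apply: BC.
by apply/ffunP => i; rewrite ffunE AB.
Qed.

End CliqueProduct.
End Subspaces.
End ChineseRemainder.
(** * The clique number and the reductions of a maximum clique *)

Lemma ratr_gauss_binom p N u : prime p ->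
  ratr (gauss_binom p (N + u) u) = gauss 'F_p N u.
Proof.
move=> p_pr; rewrite /gauss_binom /gauss rmorph_prod card_Fp //=.
rewrite (reindex_inj rev_ord_inj); apply: eq_bigr => b _ /=.
have -> : (N + u - (u - b.+1) = (N + b).+1)%N by have := ltn_ord b; lia.
have -> : (u - (u - b.+1) = b.+1)%N by have := ltn_ord b; lia.
by rewrite fmorph_div !rmorphB !rmorphXn !rmorph_nat rmorph1.
Qed.

Lemma exists_optimal_clique p s d u N n : prime p -> (0 < s)%N ->
    (d + u <= N)%N -> n = (d + u + N)%N ->
  exists2 S : {set {set 'rV['Z_(p ^ s)]_n}},
    is_clique (msubspaces (p ^ s) n (d + u))
      (grassmann_adj (p ^ s) n u.+1 (d + u)) S /\
    #|S|%:R = p%:R ^+ ((s - 1) * (u * N)) * gauss 'F_p N u &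
    forall C : {set {set 'rV['Z_(p ^ s)]_n}},
      is_clique (msubspaces (p ^ s) n (d + u))
        (grassmann_adj (p ^ s) n u.+1 (d + u)) C ->
      (#|C| <= #|S|)%N.
Proof.
move=> p_pr s_gt0 mN nE.
have upper C : is_clique (msubspaces (p ^ s) n (d + u))
    (grassmann_adj (p ^ s) n u.+1 (d + u)) C ->
    #|C|%:R <= p%:R ^+ ((s - 1) * (u * N)) * gauss 'F_p N u.
  by subst n; apply: card_clique_le.
have [S S_clique S_ge] : exists2 S : {set {set 'rV['Z_(p ^ s)]_n}},
    is_clique (msubspaces (p ^ s) n (d + u))
      (grassmann_adj (p ^ s) n u.+1 (d + u)) S &
    p%:R ^+ ((s - 1) * (u * N)) * gauss 'F_p N u <= #|S|%:R.
  rewrite -addnA in nE; subst n; exists (star_clique p s d u (u + N)).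
    exact: star_is_clique.
  exact: star_clique_ge.
exists S => [|C /upper C_le]; last by rewrite -(ler_nat algC) (le_trans C_le).
by split=> //; apply/le_anti/andP; split=> //; apply: upper.
Qed.

Lemma leq_prod_eq (I : finType) (a b : I -> nat) :
    (forall i, 0 < a i)%N -> (forall i, b i <= a i)%N ->
    (\prod_i a i <= \prod_i b i)%N -> forall i, a i = b i.
Proof.
move=> a_gt0 ba le i; apply/eqP; rewrite eqn_leq ba andbT.
have pos : (0 < \prod_(j | j != i) a j)%N by apply: prodn_gt0.
rewrite -(leq_pmul2r pos); move: le.
rewrite (bigD1 i) //= [X in (_ <= X)%N](bigD1 i) //=.
by move=> /leq_trans; apply; rewrite leq_mul2l leq_prod ?orbT.
Qed.

Theorem lemma4p3 (t : nat) (p s : 'I_t -> nat) (h n m r : nat)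
    (F : {set {set 'rV['Z_h]_n}})
    (t_gt0 : (1 <= t)%N)
    (p_prime : forall i, prime (p i))
    (p_inj : injective p)
    (s_gt0 : forall i, (0 < s i)%N)
    (h_def : h = (\prod_(i < t) p i ^ s i)%N)
    (r_ge2 : (2 <= r)%N)
    (r_le : (r <= m + 1)%N)
    (m_lt_n : (m + 1 <= n)%N)
    (n_ge : (2 * m <= n)%N)
    (F_max : grassmann_maximum_clique r m n h F) :
  (grassmann_clique_number r m n h)%:R =
    \prod_(i < t) ((p i)%:R ^+ ((s i - 1) * (n - m) * (r - 1))
                   * gauss_binom (p i) (n - m + r - 1) (r - 1)) :> rat
  /\ forall i : 'I_t,
       grassmann_maximum_clique r m n (p i ^ s i)%N
         [set Vred (p i ^ s i)%N A | A in F].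
Proof.
have K_gt1 i : (1 < p i ^ s i)%N.
  by rewrite -(exp1n (s i)) ltn_exp2r // prime_gt1.
have h_gt1 : (1 < h)%N.
  rewrite h_def (bigD1 (Ordinal t_gt0)) //=.
  rewrite (leq_trans (K_gt1 (Ordinal t_gt0))) // leq_pmulr //.
  by apply: prodn_gt0 => i; apply: ltnW.
have K_coprime i j : i != j -> coprime (p i ^ s i) (p j ^ s j).
  move=> ne; rewrite coprime_pexpl // coprime_pexpr // prime_coprime //.
  by rewrite dvdn_prime2 // (inj_eq p_inj).
have [d dE] : exists d, d = (m.+1 - r)%N by exists (m.+1 - r)%N.
have [u uE] : exists u, u = (r - 1)%N by exists (r - 1)%N.
have [N NE] : exists N, N = (n - m)%N by exists (n - m)%N.
have rE : r = u.+1 by lia.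
have mE : m = (d + u)%N by lia.
have nE : n = (d + u + N)%N by lia.
have mN : (d + u <= N)%N by lia.
have -> : (n - m + r - 1 = N + u)%N by lia.
rewrite -uE -NE; clear dE uE NE r_ge2 r_le m_lt_n n_ge; subst r m.
have [F_clique F_le] := F_max.
have /fin_all_exists2[S S_opt S_ge] i :=
  exists_optimal_clique (p_prime i) (s_gt0 i) mN nE.
pose Fi i := [set Vred (p i ^ s i) A | A in F].
have Fi_clique i : is_clique (msubspaces (p i ^ s i) n (d + u))
    (grassmann_adj (p i ^ s i) n u.+1 (d + u)) (Fi i).
  by apply: (clique_Vred K_gt1 h_gt1 K_coprime h_def).
have Fi_le i : (#|Fi i| <= #|S i|)%N by apply: S_ge.
have [D D_clique D_ge] := clique_product K_gt1 h_gt1 K_coprime h_def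
  (fun i => (S_opt i).1).
have prodS_le : (\prod_i #|S i| <= #|F|)%N := leq_trans D_ge (F_le D D_clique).
have F_le_prod : (#|F| <= \prod_i #|Fi i|)%N.
  exact: (card_clique_le_prod K_gt1 h_gt1 K_coprime h_def F_clique).
have S_gt0 i : (0 < #|S i|)%N.
  have F_gt0 : (0 < #|S i|%:R :> algC); last by rewrite ltr0n in F_gt0.
  rewrite (S_opt i).2 mulr_gt0 ?exprn_gt0 ?ltr0n ?prime_gt0 //.
  apply: prodr_gt0 => b _; have q1 := q_gt1 'F_(p i) algC.
  by rewrite divr_gt0 // subr_gt0 exprn_egt1.
have SFi := leq_prod_eq S_gt0 Fi_le (leq_trans prodS_le F_le_prod).
have cardF : #|F| = (\prod_i #|S i|)%N.
  apply/eqP; rewrite eqn_leq prodS_le andbT (leq_trans F_le_prod) //.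
  exact: leq_prod.
split=> [|i]; last first.
  by split=> [|C C_clique]; [exact: Fi_clique | rewrite -SFi S_ge].
have -> : grassmann_clique_number u.+1 (d + u) n h = #|F|.
  apply/eqP; rewrite eqn_leq; apply/andP; split; first exact/bigmax_leqP.
  exact: (@leq_bigmax_cond _ _ (fun C : {set {set 'rV['Z_h]_n}} => #|C|) F).
apply: (fmorph_inj (ratr : {rmorphism rat -> algC})).
rewrite /= ratr_nat cardF natr_prod rmorph_prod; apply: eq_bigr => i _.
rewrite (S_opt i).2 rmorphM rmorphXn rmorph_nat /= ratr_gauss_binom //.
by rewrite -mulnA [(N * u)%N]mulnC.
Qed.
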